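(* Let $\Gamma\subset\mathbb{R}$ be a closed set of Lebesgue measure zero and let $\Sigma_1,\Sigma_2\subset\Gamma$. Then for every $z\in\mathbb{C}\setminus[0,\infty)$ the set $$B(\Sigma_1,\Sigma_2)=\{g_z(\cdot-\gamma):\gamma\in\Sigma_1\}\cup\{g_z'(\cdot-\gamma):\gamma\in\Sigma_2\}$$ is a total subset of the deficiency subspace $\mathfrak{N}_{z,\Gamma}$ if and only if $\Sigma_1$ is dense in $\Gamma$ and $\Sigma_2$ contains the set of all isolated points of $\Gamma$.
   Context: For $z\in\mathbb{C}\setminus[0,\infty)$ put $g_z(x)=\frac{i}{2\sqrt z}\,e^{i\sqrt z\,|x|}$, $x\in\mathbb{R}$, where $\sqrt z$ is the square root with positive imaginary part; $g_z'$ is its derivative (defined for $x\ne0$). The operator $L_{\min,\Gamma}$ is the symmetric operator in $L_2(\mathbb{R})$ with domain $C_0^\infty(\mathbb{R}\setminus\Gamma)$ and action $L_{\min,\Gamma}\varphi=-\varphi''$, and $L_{\max,\Gamma}$ is its adjoint. The deficiency subspace is $$\mathfrak{N}_{z,\Gamma}=\operatorname{ran}(L_{\min,\Gamma}-\overline z)^{\perp}=\ker(L_{\max,\Gamma}-z).$$ A subset $B\subset\mathfrak{N}_{z,\Gamma}$ is total in $\mathfrak{N}_{z,\Gamma}$ if $\mathfrak{N}_{z,\Gamma}$ is the closure (in $L_2(\mathbb{R})$) of the linear span of $B$. *)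

(* Defs.v *)
From HB Require Import structures.
From mathcomp Require Import all_boot all_order all_algebra.
From mathcomp Require Import complex.
From mathcomp Require Import all_classical all_reals all_analysis.

Set Implicit Arguments.
Unset Strict Implicit.
Unset Printing Implicit Defensive.

Import Order.TTheory GRing.Theory Num.Theory.
Import numFieldNormedType.Exports.

Local Open Scope complex_scope.
Local Open Scope ring_scope.
Local Open Scope classical_set_scope.

(* Calculus of functions R -> R[i] is done on real and imaginary parts, since
   R[i] carries no normed-module structure over R in the library. *)
Definition reF (R : realType) (f : R -> R[i]) : R -> R := fun x => complex.Re (f x).
Definition imF (R : realType) (f : R -> R[i]) : R -> R := fun x => complex.Im (f x).

Definition cderive (R : realType) (f : R -> R[i]) : R -> R[i] :=
  fun x => (reF f)^`() x +i* (imF f)^`() x.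

Definition csmooth (R : realType) (f : R -> R[i]) : Prop :=
  forall (n : nat) (x : R),
    derivable ((reF f)^`(n)) x 1 /\ derivable ((imF f)^`(n)) x 1.

Definition cexp (R : realType) (w : R[i]) : R[i] :=
  (expR (complex.Re w))%:C * (cos (complex.Im w) +i* sin (complex.Im w)).

(* L_2(R) is handled through representatives: its elements are the square
   integrable functions R -> R[i], and the two sets of functions built below
   (orthogonal complements and closures) are saturated for a.e. equality. *)
Definition L2norm (R : realType) (f : R -> R[i]) : \bar R :=
  Lnorm lebesgue_measure 2%:E (fun x => (ComplexField.Normc.normc (f x))%:E).

Definition L2 (R : realType) : set (R -> R[i]) :=
  [set f | [/\ measurable_fun setT (reF f), measurable_fun setT (imF f)
             & (L2norm f < +oo)%E]].

Definition cintegral (R : realType) (f : R -> R[i]) : R[i] :=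
  Rintegral lebesgue_measure setT (reF f)
  +i* Rintegral lebesgue_measure setT (imF f).

Definition L2inner (R : realType) (f g : R -> R[i]) : R[i] :=
  cintegral (fun x => f x * (g x)^*%C).

Definition L2ortho (R : realType) (A : set (R -> R[i])) : set (R -> R[i]) :=
  [set f | L2 f /\ forall g, A g -> L2inner f g = 0].

Definition cspan (R : realType) (B : set (R -> R[i])) : set (R -> R[i]) :=
  [set f | exists (n : nat) (c : 'I_n -> R[i]) (b : 'I_n -> R -> R[i]),
     (forall i, B (b i)) /\ f = (fun x => \sum_(i < n) c i * b i x)].

Definition L2closure (R : realType) (A : set (R -> R[i])) : set (R -> R[i]) :=
  [set f | L2 f /\ forall e : R, 0 < e ->
     exists2 g, A g & (L2norm (fun x => f x - g x)%R < e%:E)%E].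

Definition total_in (R : realType) (B N : set (R -> R[i])) : Prop :=
  B `<=` N /\ N = L2closure (cspan B).

(* C_0^oo(R \ G), functions being extended by 0 to all of R. *)
Definition Cc_infty (R : realType) (G : set R) : set (R -> R[i]) :=
  [set phi | let supp := closure [set x | phi x != 0] in
     [/\ csmooth phi, compact supp & supp `<=` ~` G]].

(* Action of L_min; its domain is [Cc_infty G]. *)
Definition Lmin (R : realType) (phi : R -> R[i]) : R -> R[i] :=
  fun x => - cderive (cderive phi) x.

Definition deficiency (R : realType) (z : R[i]) (G : set R) :
    set (R -> R[i]) :=
  L2ortho [set (fun x => Lmin phi x - z^*%C * phi x) | phi in Cc_infty G].

(* [sqrtC z] has nonnegative imaginary part; off the half-line [0, +oo) that
   imaginary part is positive, see [sqrtC_Im_gt0]. *)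
Definition gz (R : realType) (z : R[i]) : R -> R[i] :=
  fun x => 'i%C / (2 * sqrtC z) * cexp ('i%C * sqrtC z * `|x|%:C).

(* [cderive (gz z)] takes an unspecified value at 0; this is one point per
   translate, hence invisible in L_2. *)
Definition Bset (R : realType) (z : R[i]) (S1 S2 : set R) : set (R -> R[i]) :=
  [set (fun x => gz z (x - c)) | c in S1] `|`
  [set (fun x => cderive (gz z) (x - c)) | c in S2].

(* The order of R[i] is partial: [0 <= z] means that z is real nonnegative. *)
Lemma sqrtC_Im_gt0 (R : realType) (z : R[i]) :
  ~~ (0 <= z) -> sqrtC z ^+ 2 = z /\ 0 < complex.Im (sqrtC z).
Proof.
move=> z0; split; first exact: sqrtCK.
have := @Im_rootC_ge0 _ 2 z isT.
rewrite -complexIm ler0c le_eqVlt => /orP[/eqP Im0|//].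
case/negP: z0; rewrite -[z]sqrtCK.
have -> : sqrtC z = (complex.Re (sqrtC z))%:C.
  by rewrite [LHS]complexE -Im0 mulr0 addr0.
by rewrite -rmorphXn/= ler0c sqr_ge0.
Qed.

(* Main.v *)
Require Import Defs.
From mathcomp Require Import all_boot all_order all_algebra.
From mathcomp Require Import ring lra.
From mathcomp Require Import complex.
From mathcomp Require Import all_classical all_reals all_analysis.
From mathcomp Require Import measurable_realfun.
Import Order.TTheory GRing.Theory Num.Theory.
Import numFieldNormedType.Exports.
Local Open Scope classical_set_scope.
Local Open Scope ring_scope.

(** Both directions rest on explicit formulas rather than on projections in the
    Hilbert space of square integrable functions.

    Put [w = i sqrt z], so that [w^2 = - z] and [Re w < 0], and [g_z x] is
    [- e^(w |x|) / (2 w)]. For a smooth [u] with compact support, pairing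
    [u'' + z u] with [g_z (x - c)] gives [- u c], and with the derivative of
    that translate gives [u' c] ([pairing_gz], [pairing_dgz]). As test functions
    vanish near [G], the translates by points of [G] lie in the deficiency
    subspace. The same formulas give necessity: if the generators are total, a
    smooth compactly supported [u] that vanishes on [S1] and has zero slope on
    [S2] must have zero value and zero slope at every point of [G]
    ([total_uniqueness]). When [S1] is not dense, a smooth plateau, flat on the
    null set [G], contradicts this ([total_dense]); when [S2] misses an isolated
    point [c], the function [x - c] times a bump does ([total_isolated]).

    For sufficiency, let [e_c^+] and [e_c^-] be the decaying exponentials
    [e^(w |x - c|)] restricted to [x > c] and to [x < c]. Their sum is a multiple
    of [g_z (x - c)] and their difference a multiple of its derivative. The
    closed span of the generators contains both for every [c] in [G]: the sum is
    a limit of translates by points of [S1] ([closure_abs]); the difference is a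
    multiple of a generator if [c] is isolated, and otherwise a limit of
    difference quotients of sums ([closure_sub_pm]). Now let [f] be in the deficiency subspace. It is
    a weak solution of [f'' = w^2 f] on each component of the complement of [G],
    hence equal there to [A e^(w x) + B e^(- w x)] ([weak_solution_exp]); this is
    proved by applying twice, to the factors of [(D - w) (D + w)], a lemma of du
    Bois-Reymond type ([first_order_dual]), with an explicit bump as test
    function. Restricted to a component with ends [a] and [b], such a function is
    a combination of [e_a^+], [e_b^+], [e_a^-] and [e_b^-]; an infinite end is
    excluded for the growing exponential by square integrability
    ([closure_cut]). Finally [f] is the limit of its restrictions to finitely
    many components, because [G] is null ([deficiency_sub_closure]). *)

Local Notation Re := complex.Re.
Local Notation Im := complex.Im.
Local Notation normc := ComplexField.Normc.normc.

(** * Derivatives of complex functions of a real variable *)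

Section complex_calculus.
Context {R : realType}.
Local Notation C := R[i].
Implicit Types (f g : R -> C) (w : C).

Lemma complex_eq (x y : C) : Re x = Re y -> Im x = Im y -> x = y.
Proof. by case: x y => [a b] [c d] /= -> ->. Qed.

Lemma ReD (x y : C) : Re (x + y) = Re x + Re y.
Proof. by case: x y => [a b] [c d]. Qed.
Lemma ImD (x y : C) : Im (x + y) = Im x + Im y.
Proof. by case: x y => [a b] [c d]. Qed.
Lemma ReN (x : C) : Re (- x) = - Re x.
Proof. by case: x. Qed.
Lemma ImN (x : C) : Im (- x) = - Im x.
Proof. by case: x. Qed.
Lemma ReM (x y : C) : Re (x * y) = Re x * Re y - Im x * Im y.
Proof. by case: x y => [a b] [c d]. Qed.
Lemma ImM (x y : C) : Im (x * y) = Re x * Im y + Im x * Re y.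
Proof. by case: x y => [a b] [c d]. Qed.
Lemma Re_conjc (x : C) : Re (x^*)%C = Re x.
Proof. by case: x. Qed.
Lemma Im_conjc (x : C) : Im (x^*)%C = - Im x.
Proof. by case: x. Qed.
Definition ReImE := (ReD, ImD, ReN, ImN, ReM, ImM, Re_conjc, Im_conjc).

Definition is_cder f (x : R) (d : C) :=
  is_derive x 1 (reF f) (Re d) /\ is_derive x 1 (imF f) (Im d).

Lemma is_cder_eq f x d d' : is_cder f x d -> d = d' -> is_cder f x d'.
Proof. by move=> ? <-. Qed.

Lemma is_cderE f x d : is_cder f x d -> cderive f x = d.
Proof.
move=> [[_ h1] [_ h2]]; rewrite /cderive !derive1E h1 h2.
exact: complex_eq.
Qed.

Lemma is_cder_cst (c : C) x : is_cder (fun=> c) x 0.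
Proof. by split; exact: is_derive_cst. Qed.

Lemma is_cderD f g x df dg : is_cder f x df -> is_cder g x dg ->
  is_cder (fun y => f y + g y) x (df + dg).
Proof.
move=> [f1 f2] [g1 g2]; split.
- have -> : reF (fun y => f y + g y) = reF f + reF g.
    by apply/funext => y; rewrite /reF ReD.
  by apply: is_derive_eq; rewrite ReD.
- have -> : imF (fun y => f y + g y) = imF f + imF g.
    by apply/funext => y; rewrite /imF ImD.
  by apply: is_derive_eq; rewrite ImD.
Qed.

Lemma is_cderM f g x df dg : is_cder f x df -> is_cder g x dg ->
  is_cder (fun y => f y * g y) x (df * g x + f x * dg).
Proof.
move=> [f1 f2] [g1 g2]; split.
- have -> : reF (fun y => f y * g y) = reF f * reF g - imF f * imF g.
    by apply/funext => y; rewrite /reF /imF ReM.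
  apply: is_derive_eq; rewrite !ReImE /reF /imF /GRing.scale/=; ring.
- have -> : imF (fun y => f y * g y) = reF f * imF g + imF f * reF g.
    by apply/funext => y; rewrite /reF /imF ImM.
  apply: is_derive_eq; rewrite !ReImE /reF /imF /GRing.scale/=; ring.
Qed.

Lemma is_cderZ f (c : C) x df : is_cder f x df ->
  is_cder (fun y => c * f y) x (c * df).
Proof.
move=> h; apply: is_cder_eq (is_cderM (fun=> c) _ _ _ _ (is_cder_cst c x) h) _.
by rewrite mul0r add0r.
Qed.

Lemma is_cderN f x df : is_cder f x df -> is_cder (fun y => - f y) x (- df).
Proof.
move=> h; have := is_cderZ _ (-1) _ _ h; rewrite mulN1r.
by congr (is_cder _ _ _); apply/funext => y; rewrite mulN1r.
Qed.

Lemma is_cderB f g x df dg : is_cder f x df -> is_cder g x dg ->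
  is_cder (fun y => f y - g y) x (df - dg).
Proof. by move=> hf /is_cderN; exact: is_cderD. Qed.

Lemma is_cder_conj f x df : is_cder f x df ->
  is_cder (fun y => (f y)^*%C) x df^*%C.
Proof.
move=> [h1 h2]; split.
- have -> : reF (fun y => (f y)^*%C) = reF f.
    by apply/funext => y; rewrite /reF Re_conjc.
  by rewrite Re_conjc.
- have -> : imF (fun y => (f y)^*%C) = - imF f.
    by apply/funext => y; rewrite /imF Im_conjc.
  by apply: is_derive_eq; rewrite Im_conjc.
Qed.

Lemma is_cder_real (f : R -> R) (x d : R) : is_derive x (1 : R) f d ->
  is_cder (fun y => (f y)%:C%C) x d%:C%C.
Proof. by move=> h; split => //=; exact: is_derive_cst. Qed.

Lemma near_is_cder f g x d : (\forall y \near x, f y = g y) ->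
  is_cder f x d -> is_cder g x d.
Proof.
move=> fg [h1 h2]; split.
- by apply: near_eq_is_derive h1; near=> y; rewrite /reF; congr Re; near: y.
- by apply: near_eq_is_derive h2; near=> y; rewrite /imF; congr Im; near: y.
Unshelve. all: end_near. Qed.

End complex_calculus.

(** * Complex exponentials *)

Section complex_exponential.
Context {R : realType}.
Local Notation C := R[i].
Implicit Types (f g : R -> C) (w : C).

Lemma cexpD (a b : C) : cexp (a + b) = cexp a * cexp b.
Proof.
apply: complex_eq; rewrite /cexp !ReImE/= expRD ?cosD ?sinD; ring.
Qed.

Lemma cexp0 : cexp (0 : C) = 1.
Proof. by rewrite /cexp /= expR0 cos0 sin0 mul1r. Qed.

Lemma normc_cexp (w : C) : normc (cexp w) = expR (Re w).
Proof.
rewrite /cexp ComplexField.Normc.normcM /= cos2Dsin2 sqrtr1 mulr1.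
by rewrite expr0n /= addr0 sqrtr_sqr gtr0_norm ?expR_gt0.
Qed.

Definition wexp (w : C) (x : R) : C := cexp (w * x%:C%C).

Lemma wexpD w x y : wexp w (x + y) = wexp w x * wexp w y.
Proof. by rewrite /wexp -cexpD rmorphD /= mulrDr. Qed.

Lemma wexp0 w : wexp w 0 = 1.
Proof. by rewrite /wexp mulr0 cexp0. Qed.

Lemma wexpN w x : wexp (- w) x = wexp w (- x).
Proof. by rewrite /wexp rmorphN /= mulrN mulNr. Qed.

Lemma wexpNK w x : wexp w x * wexp (- w) x = 1.
Proof. by rewrite wexpN -wexpD subrr wexp0. Qed.

Lemma normc_wexp w x : normc (wexp w x) = expR (Re w * x).
Proof. by rewrite normc_cexp ReM /= mulr0 subr0. Qed.

Lemma is_cder_wexp w x : is_cder (wexp w) x (w * wexp w x).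
Proof.
case: w => a b; split.
- have -> : reF (wexp (a +i* b)%C) = (fun y => expR (a * y) * cos (b * y)).
    apply/funext => y; rewrite /reF /wexp /cexp !ReImE/=.
    by rewrite !(mulr0, mul0r, subr0, add0r, addr0).
  apply: is_derive_eq; rewrite /wexp /cexp !ReImE/=.
  rewrite /GRing.scale/=.
  by rewrite !(mulr0, mul0r, subr0, add0r, addr0, mulr1); ring.
- have -> : imF (wexp (a +i* b)%C) = (fun y => expR (a * y) * sin (b * y)).
    apply/funext => y; rewrite /imF /wexp /cexp !ReImE/=.
    by rewrite !(mulr0, mul0r, subr0, add0r, addr0).
  apply: is_derive_eq; rewrite /wexp /cexp !ReImE/=.
  rewrite /GRing.scale/=.
  by rewrite !(mulr0, mul0r, subr0, add0r, addr0, mulr1); ring.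
Qed.

End complex_exponential.

(** * Smooth functions *)

Section smooth_functions.
Context {R : realType}.
Local Notation C := R[i].
Implicit Types (f g : R -> C) (w : C).

Lemma csmooth_cderive f : csmooth f ->
  csmooth (cderive f) /\ forall x, is_cder f x (cderive f x).
Proof.
move=> sf; split => [n x|x].
  by have := sf n.+1 x; rewrite !derive1Sn.
have [h1 h2] := sf 0%N x.
by split; rewrite /= derive1E; exact: derivableP.
Qed.

Inductive alg_gen (S : set (R -> C)) : set (R -> C) :=
| alg_base f : S f -> alg_gen S f
| alg_add f g : alg_gen S f -> alg_gen S g -> alg_gen S (fun x => f x + g x)
| alg_mul f g : alg_gen S f -> alg_gen S g -> alg_gen S (fun x => f x * g x).

(** By the Leibniz rule, the algebra generated by [S] is stable under
differentiation as soon as the derivatives of the generators lie in it.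
Smoothness follows without any formula for the [n]-th derivative. *)
Lemma csmooth_alg_gen (S : set (R -> C)) :
  (forall f, S f -> exists2 f', alg_gen S f' & forall x, is_cder f x (f' x)) ->
  alg_gen S `<=` @csmooth R.
Proof.
move=> Sder.
have genD f : alg_gen S f ->
    exists2 f', alg_gen S f' & forall x, is_cder f x (f' x).
  elim=> {f} [f /Sder//|f g _ [f' ? df] _ [g' ? dg]|f g Sf [f' ? df] Sg [g' ? dg]].
  - by exists (fun x => f' x + g' x); [exact: alg_add|move=> x; exact: is_cderD].
  - exists (fun x => f' x * g x + f x * g' x).
      by apply: alg_add; apply: alg_mul.
    by move=> x; exact: is_cderM.
move=> f Sf n.
have [g Sg [h1 h2]] : exists2 g, alg_gen S g &
    derive1n n (reF f) = reF g /\ derive1n n (imF f) = imF g.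
  elim: n => [|n [g Sg [h1 h2]]]; first by exists f.
  have [g' Sg' dg] := genD _ Sg; exists g' => //; rewrite !derive1nS h1 h2.
  have := fun x => is_cderE _ _ _ (dg x).
  by split; apply/funext => x; rewrite /reF /imF -[g' x]H.
have [g' _ dg] := genD _ Sg.
move=> x; rewrite h1 h2; have [d1 d2] := dg x.
by split; apply: ex_derive.
Qed.

Lemma csmoothS f f' : csmooth f' -> (forall x, is_cder f x (f' x)) -> csmooth f.
Proof.
move=> sf' df; apply: (csmooth_alg_gen [set g | csmooth g \/ g = f]); last first.
  by apply: alg_base; right.
move=> g [sg|->]; last by exists f' => //; apply: alg_base; left.
have [? ?] := csmooth_cderive _ sg.
by exists (cderive g) => //; apply: alg_base; left.
Qed.

Lemma csmooth_closed f : alg_gen (@csmooth R) f -> csmooth f.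
Proof.
apply: csmooth_alg_gen => g sg; have [? ?] := csmooth_cderive _ sg.
by exists (cderive g) => //; exact: alg_base.
Qed.

Lemma csmoothD f g : csmooth f -> csmooth g -> csmooth (fun x => f x + g x).
Proof. by move=> ? ?; apply: csmooth_closed; apply: alg_add; apply: alg_base. Qed.

Lemma csmoothM f g : csmooth f -> csmooth g -> csmooth (fun x => f x * g x).
Proof. by move=> ? ?; apply: csmooth_closed; apply: alg_mul; apply: alg_base. Qed.

Lemma csmooth_cst (c : C) : csmooth (fun=> c).
Proof.
apply: (csmooth_alg_gen [set f | exists d, f = fun=> d]).
  move=> _ [d ->]; exists (fun=> 0); last by move=> x; exact: is_cder_cst.
  by apply: alg_base; exists 0.
by apply: alg_base; exists c.
Qed.

Lemma csmoothZ f (c : C) : csmooth f -> csmooth (fun x => c * f x).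
Proof. by move=> sf; exact: (csmoothM _ _ (csmooth_cst c) sf). Qed.

Lemma csmoothB f g : csmooth f -> csmooth g -> csmooth (fun x => f x - g x).
Proof.
move=> sf sg.
suff -> : (fun x => f x - g x) = (fun x => f x + (-1) * g x).
  exact: (csmoothD _ _ sf (csmoothZ _ _ sg)).
by apply/funext => x; rewrite mulN1r.
Qed.

Lemma csmooth_conj f : csmooth f -> csmooth (fun x => (f x)^*%C).
Proof.
move=> sf; pose S : set (R -> C) := [set g | exists2 h, csmooth h & g = fun x => (h x)^*%C].
have : alg_gen S `<=` @csmooth R; last by apply; apply: alg_base; exists f.
apply: csmooth_alg_gen.
move=> _ [h sh ->]; have [sh' dh] := csmooth_cderive _ sh.
exists (fun x => (cderive h x)^*%C); first by apply: alg_base; exists (cderive h).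
by move=> x; exact: is_cder_conj.
Qed.

Lemma csmooth_wexp w : csmooth (wexp w).
Proof.
apply: (csmooth_alg_gen [set f | exists c, f = fun x => c * wexp w x]).
  move=> _ [c ->]; exists (fun x => (c * w) * wexp w x).
    by apply: alg_base; exists (c * w).
  by move=> x; rewrite -mulrA; apply: is_cderZ; exact: is_cder_wexp.
by apply: alg_base; exists 1; apply/funext => x; rewrite mul1r.
Qed.

Lemma csmooth_id : csmooth (fun x : R => x%:C%C).
Proof.
apply: (csmoothS _ (fun=> 1)); first exact: csmooth_cst.
by move=> x; apply: is_cder_real; exact: is_derive_id.
Qed.

End smooth_functions.

(** * Smooth bumps *)

Section bump.
Context {R : realType}.
Local Notation C := R[i].

(** These functions form a family stable under differentiation up to linear
combinations; [theta 0] is the classical flat function [e^(-1/x)]. *)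
Definition theta n (x : R) : R := if 0 < x then x ^- n * expR (- x^-1) else 0.

Lemma theta0E (x : R) : 0 < x -> theta 0 x = expR (- x^-1).
Proof. by move=> x0; rewrite /theta x0 invr1 mul1r. Qed.

Lemma theta_out n (x : R) : x <= 0 -> theta n x = 0.
Proof. by move=> x0; rewrite /theta ltNge x0. Qed.

(** One term of the exponential series at [1/x] beats the pole of order [n]
with two powers of [x] to spare. *)
Lemma theta_le_sqr n (x : R) : `|theta n x| <= n.+2`!%:R * x ^+ 2.
Proof.
rewrite /theta; case: ifPn => [x0|_]; last first.
  by rewrite normr0 mulr_ge0// sqr_ge0.
rewrite ger0_norm; last by rewrite mulr_ge0 ?expR_ge0// invr_ge0 exprn_ge0// ltW.
have := @expR_ge1Dxn R x^-1 n.+1; rewrite invr_ge0 (ltW x0) => /(_ isT) h.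
have {h} h2 : x ^- n.+2 / n.+2`!%:R <= expR x^-1.
  by rewrite -exprVn; apply: le_trans h; rewrite lerDr.
rewrite expRN ler_pdivrMr ?expR_gt0//.
rewrite -mulrA.
have -> : x ^- n = n.+2`!%:R * (x ^+ 2 * (x ^- n.+2 / n.+2`!%:R)).
  have f0 : n.+2`!%:R != 0 :> R by rewrite pnatr_eq0 -lt0n fact_gt0.
  have xn0 : x != 0 by rewrite gt_eqF.
  by rewrite -(addn2 n) exprD; field; rewrite addn2 f0 xn0 expf_neq0.
by rewrite ler_wpM2l// ler_wpM2l// sqr_ge0.
Qed.

Lemma is_derive_sqr_bound (f : R -> R) (K : R) :
  (forall x, `|f x| <= K * x ^+ 2) -> is_derive (0 : R) 1 f 0.
Proof.
move=> fK.
have f0 : f 0 = 0.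
  by apply/eqP; rewrite -normr_le0 (le_trans (fK _))// expr0n mulr0.
apply/is_derive1_caratheodory; exists (fun x => f x / x); split.
- move=> z; rewrite f0 !subr0; have [->|z0] := eqVneq z 0.
    by rewrite f0 mulr0.
  by rewrite divfK.
- suff h : f x / x @[x --> (0 : R)] --> (0 : R).
    by change (f x / x @[x --> (0 : R)] --> f 0 / 0); rewrite f0 mul0r.
  apply/cvgr0Pnorm_le => e e0.
  have eK0 : 0 < e / (`|K| + 1) by rewrite divr_gt0// ltr_wpDl.
  near=> x.
  have [->|x0] := eqVneq x 0; first by rewrite invr0 mulr0 normr0 ltW.
  rewrite normrM normfV ler_pdivrMr ?normr_gt0//.
  have xe : `|x| <= e / (`|K| + 1).
    by near: x; exact: (@nbhs0_le _ R^o _ eK0).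
  apply: le_trans (fK x) _; rewrite -real_normK ?num_real// expr2 mulrA.
  rewrite ler_pM2r ?normr_gt0//.
  apply: (@le_trans _ _ ((`|K| + 1) * `|x|)).
    by rewrite ler_wpM2r// (le_trans (ler_norm _))// lerDl.
  by rewrite mulrC -ler_pdivlMr ?ltr_wpDl.
- by rewrite f0 mul0r.
Unshelve. all: end_near. Qed.

(** At the origin the quadratic flatness makes the difference quotient vanish;
elsewhere this is the product rule. *)
Lemma is_derive_theta n (x : R) :
  is_derive x 1 (theta n) (- n%:R * theta n.+1 x + theta n.+2 x).
Proof.
have [x0|x0|->] := ltgtP x 0.
- have -> : - n%:R * theta n.+1 x + theta n.+2 x = 0.
    by rewrite /theta ltNge (ltW x0)/= mulr0 addr0.
  apply: near_eq_is_derive (is_derive_cst (0 : R) _ _).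
  near=> y; rewrite /theta ltNge.
  have /ltW -> // : y < 0.
  by near: y; exact: lt_nbhsl.
- have xn0 : x != 0 by rewrite gt_eqF.
  have -> : - n%:R * theta n.+1 x + theta n.+2 x =
      (- n%:R * x ^- n.+1 + x ^- n.+2) * expR (- x^-1).
    by rewrite /theta x0; ring.
  suff : is_derive x 1
      ((fun y : R => y^-1) ^+ n * (expR \o (fun y : R => - y^-1)))
      ((- n%:R * x ^- n.+1 + x ^- n.+2) * expR (- x^-1)).
    apply: near_eq_is_derive; near=> y.
    by rewrite /theta !fctE /= exprVn; have -> : 0 < y by near: y; exact: lt_nbhsr.
  have dV : is_derive x 1 (fun y : R => y^-1) (- x ^- 2).
    apply: is_derive_eq (@is_deriveV _ id x 1 1 _ _) _ => //.
    by rewrite /GRing.scale/= mulr1.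
  have dE : is_derive x 1 (expR \o (fun y : R => - y^-1)) (expR (- x^-1) * x ^- 2).
    apply: is_derive1_comp; apply: is_derive_eq; exact: opprK.
  have dX : is_derive x 1 ((fun y : R => y^-1) ^+ n) (n%:R * x^-1 ^+ n.-1 * - x ^- 2).
    by apply: is_derive_eq.
  apply: is_derive_eq; rewrite !fctE.
  rewrite /GRing.scale/=. rewrite -!exprVn {dX}.
  case: n => [|n]; rewrite /= ?mulr0n.
    by rewrite !exprSr; ring.
  by rewrite !exprSr; ring.
- have -> : - n%:R * theta n.+1 0 + theta n.+2 0 = 0 :> R.
    by rewrite /theta ltxx mulr0 addr0.
  exact: is_derive_sqr_bound (theta_le_sqr n).
Unshelve. all: end_near. Qed.

Lemma csmooth_theta n (a b : R) : csmooth (fun x : R => (theta n (a * x + b))%:C%C).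
Proof.
pose S := [set f | exists c m, f = fun x : R => (c * theta m (a * x + b))%:C%C].
apply: (csmooth_alg_gen S); last first.
  by apply: alg_base; exists 1, n; apply/funext => x; rewrite mul1r.
move=> _ [c [m ->]].
exists (fun x => (c * a * - m%:R * theta m.+1 (a * x + b))%:C%C +
                 (c * a * theta m.+2 (a * x + b))%:C%C).
  by apply: alg_add; apply: alg_base; [exists (c * a * - m%:R), m.+1|exists (c * a), m.+2].
move=> x; rewrite -rmorphD /=; apply: is_cder_real.
have dth := is_derive_theta m (a * x + b).
have daff : is_derive x 1 (fun x : R => a * x + b) a.
  by apply: is_derive_eq; rewrite /GRing.scale/= mulr1 addr0.
have := @is_derive1_comp _ _ (fun x : R => a * x + b) _ _ _ dth daff => dcomp.
have -> : (fun y : R => c * theta m (a * y + b)) =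
          c *: (theta m \o (fun x : R => a * x + b)) by [].
by apply: is_derive_eq; rewrite /GRing.scale/=; ring.
Qed.

(** As [k] grows, these functions tend to the indicator of [`]c, d[] while
staying between 0 and 1, so that integrating against them recovers integrals
over intervals. *)
Definition bump (c d k x : R) : R := theta 0 (k * (x - c)) * theta 0 (k * (d - x)).

Lemma csmooth_bump c d k : csmooth (fun x => (bump c d k x)%:C%C).
Proof.
have -> : (fun x => (bump c d k x)%:C%C) = fun x : R =>
    (theta 0 (k * x + - (k * c)))%:C%C * (theta 0 (- k * x + k * d))%:C%C.
  apply/funext => x; rewrite -rmorphM /= /bump; congr (_ %:C)%C.
  by congr (theta _ _ * theta _ _); ring.
by apply: csmoothM; exact: csmooth_theta.
Qed.

Lemma theta0_ge0 (x : R) : 0 <= theta 0 x.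
Proof. by rewrite /theta; case: ifP; rewrite // invr1 mul1r expR_ge0. Qed.

Lemma theta0_le1 (x : R) : theta 0 x <= 1.
Proof.
rewrite /theta; case: ifP => // x0.
by rewrite invr1 mul1r expR_le1 oppr_le0 invr_ge0 ltW.
Qed.

Lemma bump_ge0 c d k x : 0 <= bump c d k x.
Proof. by rewrite mulr_ge0 ?theta0_ge0. Qed.

Lemma bump_le1 c d k x : bump c d k x <= 1.
Proof. by rewrite mulr_ile1 ?theta0_ge0 ?theta0_le1. Qed.

Lemma bump_gt0 c d k x : 0 < k -> c < x < d -> 0 < bump c d k x.
Proof.
move=> k0 /andP[cx xd].
by rewrite mulr_gt0 // theta0E ?expR_gt0// mulr_gt0// subr_gt0.
Qed.

Lemma bump_out c d k x : 0 < k -> ~~ (c < x < d) -> bump c d k x = 0.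
Proof.
move=> k0; rewrite negb_and -!leNgt /bump => /orP[h|h].
- by rewrite [X in X * _]theta_out ?mul0r// pmulr_rle0// subr_le0.
- by rewrite [X in _ * X]theta_out ?mulr0// pmulr_rle0// subr_le0.
Qed.

Lemma cvg_theta0 (t : R) : 0 < t -> theta 0 (n.+1%:R * t) @[n --> \oo] --> (1 : R).
Proof.
move=> t0.
have -> : (fun n : nat => theta 0 (n.+1%:R * t)) = fun n => expR (- t^-1 * n.+1%:R^-1).
  apply/funext => n; rewrite /theta pmulr_rgt0// t0 invr1 mul1r invfM.
  by rewrite mulNr mulrC.
rewrite -[X in _ --> X]expR0; apply: continuous_cvg; first exact: continuous_expR.
rewrite -[X in _ --> X](mulr0 (- t^-1)); apply: cvgM; first exact: cvg_cst.
exact: cvg_harmonic.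
Qed.

Lemma cvg_bump c d x : c < x < d -> bump c d n.+1%:R x @[n --> \oo] --> (1 : R).
Proof.
move=> /andP[cx xd]; rewrite -[X in _ --> X](mulr1 1).
by apply: cvgM; apply: cvg_theta0; rewrite subr_gt0.
Qed.

End bump.

(** * Square integrable functions *)

Section square_integrable.
Context {R : realType}.
Local Notation C := R[i].
Local Notation mu := (@lebesgue_measure R).
Implicit Types (f g h : R -> C) (w : C).

Lemma ae_imply (P Q : R -> Prop) : (forall x, P x -> Q x) ->
  {ae mu, forall x, P x} -> {ae mu, forall x, Q x}.
Proof. by move=> PQ; apply: filterS; first exact: (ae_filter_ringOfSetsType mu). Qed.

Lemma ae_and (P Q : R -> Prop) : {ae mu, forall x, P x} -> {ae mu, forall x, Q x} ->
  {ae mu, forall x, P x /\ Q x}.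
Proof. by apply: filterS2; first exact: (ae_filter_ringOfSetsType mu). Qed.

Lemma integrableZlR (k : R) (f : R -> R) : mu.-integrable setT (EFin \o f) ->
  mu.-integrable setT (EFin \o (fun x => k * f x)).
Proof. by move=> fi; exact: (@integrableZl _ _ _ mu setT measurableT k _ fi). Qed.

Lemma integrableDR (f g : R -> R) : mu.-integrable setT (EFin \o f) ->
  mu.-integrable setT (EFin \o g) -> mu.-integrable setT (EFin \o (fun x => f x + g x)).
Proof. by move=> fi gi; exact: (@integrableD _ _ _ mu setT measurableT _ _ fi gi). Qed.

Lemma integrable_leR (f g : R -> R) : measurable_fun setT f ->
  (forall x, `|f x| <= g x) -> mu.-integrable setT (EFin \o g) ->
  mu.-integrable setT (EFin \o f).
Proof.
move=> mf fg; apply: le_integrable => //; first exact/measurable_EFinP.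
by move=> x _ /=; rewrite lee_fin (le_trans (fg x))// ler_norm.
Qed.

Definition cmeasurable f := measurable_fun setT (reF f) /\ measurable_fun setT (imF f).

Lemma cmeasurableD f g : cmeasurable f -> cmeasurable g -> cmeasurable (fun x => f x + g x).
Proof.
move=> [? ?] [? ?]; split.
- under [X in measurable_fun _ X]eq_fun do rewrite /reF ReD.
  exact: measurable_funD.
- under [X in measurable_fun _ X]eq_fun do rewrite /imF ImD.
  exact: measurable_funD.
Qed.

Lemma cmeasurableM f g : cmeasurable f -> cmeasurable g -> cmeasurable (fun x => f x * g x).
Proof.
move=> [? ?] [? ?]; split.
- under [X in measurable_fun _ X]eq_fun do rewrite /reF ReM.
  by apply: measurable_funB; exact: measurable_funM.
- under [X in measurable_fun _ X]eq_fun do rewrite /imF ImM.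
  by apply: measurable_funD; exact: measurable_funM.
Qed.

Lemma cmeasurable_cst (c : C) : cmeasurable (fun=> c).
Proof. by split; exact: measurable_cst. Qed.

Lemma cmeasurableZ f (c : C) : cmeasurable f -> cmeasurable (fun x => c * f x).
Proof. by apply: cmeasurableM; exact: cmeasurable_cst. Qed.

Lemma cmeasurableN f : cmeasurable f -> cmeasurable (fun x => - f x).
Proof.
move=> [? ?]; split.
- under [X in measurable_fun _ X]eq_fun do rewrite /reF ReN.
  exact: measurableT_comp.
- under [X in measurable_fun _ X]eq_fun do rewrite /imF ImN.
  exact: measurableT_comp.
Qed.

Lemma cmeasurableB f g : cmeasurable f -> cmeasurable g -> cmeasurable (fun x => f x - g x).
Proof. by move=> ? ?; apply: cmeasurableD => //; exact: cmeasurableN. Qed.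

Lemma cmeasurable_if (b : R -> bool) f g : measurable_fun setT b ->
  cmeasurable f -> cmeasurable g -> cmeasurable (fun x => if b x then f x else g x).
Proof.
move=> mb [? ?] [? ?]; split.
- have -> : reF (fun x => if b x then f x else g x) =
            fun x => if b x then reF f x else reF g x.
    by apply/funext => x; rewrite /reF; case: ifP.
  exact: measurable_fun_ifT.
- have -> : imF (fun x => if b x then f x else g x) =
            fun x => if b x then imF f x else imF g x.
    by apply/funext => x; rewrite /imF; case: ifP.
  exact: measurable_fun_ifT.
Qed.

Lemma cder_continuous f f' : (forall x, is_cder f x (f' x)) ->
  continuous (reF f) /\ continuous (imF f).
Proof.
move=> df; split => x; apply/differentiable_continuous/derivable1_diffP;
  by have [[? _] [? _]] := df x.
Qed.

Lemma csmooth_continuous f : csmooth f -> continuous (reF f) /\ continuous (imF f).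
Proof. by move=> /csmooth_cderive[_]; exact: cder_continuous. Qed.

Lemma cmeasurable_continuous f : continuous (reF f) /\ continuous (imF f) -> cmeasurable f.
Proof. by move=> [? ?]; split; exact: continuous_measurable_fun. Qed.

Lemma cmeasurable_csmooth f : csmooth f -> cmeasurable f.
Proof. by move=> /csmooth_continuous /cmeasurable_continuous. Qed.

Definition normsq (z : C) : R := Re z ^+ 2 + Im z ^+ 2.

Lemma normsq_ge0 z : 0 <= normsq z.
Proof. by rewrite addr_ge0 ?sqr_ge0. Qed.

Lemma normsqE z : normsq z = normc z ^+ 2.
Proof. by case: z => a b; rewrite /normsq /= sqr_sqrtr// addr_ge0 ?sqr_ge0. Qed.

Lemma normsqM (y z : C) : normsq (y * z) = normsq y * normsq z.
Proof. by rewrite !normsqE ComplexField.Normc.normcM exprMn. Qed.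

Lemma normsqN (z : C) : normsq (- z) = normsq z.
Proof. by rewrite /normsq ReN ImN !sqrrN. Qed.

Lemma normsq0 : normsq 0 = 0.
Proof. by rewrite /normsq /= expr0n addr0. Qed.

Lemma normsq_eq0 (z : C) : normsq z = 0 -> z = 0.
Proof.
move=> /eqP; rewrite paddr_eq0 ?sqr_ge0// !sqrf_eq0 => /andP[/eqP ? /eqP ?].
exact: complex_eq.
Qed.

Lemma normsqD_le (y z : C) : normsq (y + z) <= 2 * (normsq y + normsq z).
Proof.
rewrite /normsq ReD ImD.
have := sqr_ge0 (Re y - Re z); have := sqr_ge0 (Im y - Im z); lra.
Qed.

(** Arithmetic-geometric inequality with a free weight [t]. Choosing [t] after
the two norms are known gives what Cauchy-Schwarz would give. *)
Lemma norm_ReM_le (t : R) (y z : C) : 0 < t -> `|Re (y * z)| <= t^-1 * normsq y + t * normsq z.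
Proof.
move=> t0; rewrite ReM /normsq.
rewrite ler_norml.
have h (a b : R) : - (t^-1 * a ^+ 2 + t * b ^+ 2) <= 2 * (a * b) <= t^-1 * a ^+ 2 + t * b ^+ 2.
  have h1 : 0 <= t^-1 * (a - t * b) ^+ 2 by rewrite mulr_ge0 ?sqr_ge0 ?invr_ge0 ?ltW.
  have h2 : 0 <= t^-1 * (a + t * b) ^+ 2 by rewrite mulr_ge0 ?sqr_ge0 ?invr_ge0 ?ltW.
  have e1 : t^-1 * (a - t * b) ^+ 2 = t^-1 * a ^+ 2 - 2 * (a * b) + t * b ^+ 2.
    by field; rewrite gt_eqF.
  have e2 : t^-1 * (a + t * b) ^+ 2 = t^-1 * a ^+ 2 + 2 * (a * b) + t * b ^+ 2.
    by field; rewrite gt_eqF.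
  lra.
have a0 (a : R) : 0 <= t^-1 * a ^+ 2 by rewrite mulr_ge0 ?sqr_ge0 ?invr_ge0 ?ltW.
have b0 (a : R) : 0 <= t * a ^+ 2 by rewrite mulr_ge0 ?sqr_ge0 ?ltW.
have := h (Re y) (Re z); have := h (Im y) (Im z).
have := a0 (Re y); have := a0 (Im y); have := b0 (Re z); have := b0 (Im z).
lra.
Qed.

Lemma measurable_normsq f : cmeasurable f -> measurable_fun setT (fun x => normsq (f x)).
Proof.
by move=> [? ?]; apply: measurable_funD; exact: measurable_funX.
Qed.

Lemma emeasurable_normsq f : cmeasurable f -> measurable_fun setT (fun x => (normsq (f x))%:E : \bar R).
Proof. by move=> ?; apply/measurable_EFinP; exact: measurable_normsq. Qed.

(** The square of the norm: it is additive up to a factor 2 and homogeneous,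
which is enough for closures and avoids square roots. *)
Definition L2sq f : \bar R := (\int[mu]_x (normsq (f x))%:E)%E.

Lemma L2sq_ge0 f : (0 <= L2sq f)%E.
Proof. by apply: integral_ge0 => x _; rewrite lee_fin normsq_ge0. Qed.

Lemma L2normE f : L2norm f = (L2sq f `^ 2^-1)%E.
Proof.
rewrite /L2norm unlock /=; congr (_ `^ _)%E; apply: eq_integral => x _.
rewrite /= ger0_norm; last by rewrite -[normc _]mulr1; case: (f x) => a b; rewrite mulr1 sqrtr_ge0.
by rewrite normsqE powR_mulrn//; case: (f x) => a b; rewrite sqrtr_ge0.
Qed.

Lemma L2norm_lty f : (L2norm f < +oo)%E <-> (L2sq f < +oo)%E.
Proof.
rewrite L2normE; have := L2sq_ge0 f.
case: (L2sq f) => [r|//|//] r0.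
- by rewrite poweR_EFin !ltry.
- split => //; rewrite poweRyr ?invr_eq0 ?pnatr_eq0//.
Qed.

Lemma L2norm_lt f (e : R) : 0 < e -> (L2norm f < e%:E)%E <-> (L2sq f < (e ^+ 2)%:E)%E.
Proof.
move=> e0; rewrite L2normE; have := L2sq_ge0 f.
case: (L2sq f) => [r|//|//] r0.
- rewrite poweR_EFin !lte_fin powR12_sqrt// -[e in X in X <-> _](gtr0_norm e0).
  by rewrite -sqrtr_sqr ltr_sqrt// exprn_gt0.
- by rewrite poweRyr// invr_eq0 pnatr_eq0.
Qed.

Lemma L2P f : L2 f <-> cmeasurable f /\ (L2sq f < +oo)%E.
Proof.
split=> [[? ? /L2norm_lty ?]//|[[? ?] ?]].
by split => //; apply/L2norm_lty.
Qed.

Lemma L2_cmeasurable f : L2 f -> cmeasurable f.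
Proof. by case. Qed.

Lemma L2sqD_le f g : cmeasurable f -> cmeasurable g ->
  (L2sq (fun x => f x + g x)%R <= 2%:E * (L2sq f + L2sq g))%E.
Proof.
move=> mf mg; rewrite -ge0_integralD//; last 4 first.
  by move=> x _; rewrite lee_fin normsq_ge0.
  exact: emeasurable_normsq.
  by move=> x _; rewrite lee_fin normsq_ge0.
  exact: emeasurable_normsq.
rewrite -ge0_integralZl//; last first.
  by move=> x _; rewrite -EFinD lee_fin addr_ge0 ?normsq_ge0.
  by apply: emeasurable_funD; exact: emeasurable_normsq.
apply: ge0_le_integral => //.
- by move=> x _; rewrite lee_fin normsq_ge0.
- by apply: emeasurable_normsq; exact: cmeasurableD.
- apply: measurable_funeM.
  by apply: emeasurable_funD; exact: emeasurable_normsq.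
- by move=> x _; rewrite -EFinD -EFinM lee_fin normsqD_le.
Qed.

Lemma L2sqZ f (c : C) : cmeasurable f ->
  (L2sq (fun x => c * f x)%R = (normsq c)%:E * L2sq f)%E.
Proof.
move=> mf; rewrite /L2sq -ge0_integralZl//.
- by apply: eq_integral => x _; rewrite normsqM EFinM.
- exact: emeasurable_normsq.
- by move=> x _; rewrite lee_fin normsq_ge0.
- by rewrite lee_fin normsq_ge0.
Qed.

Lemma L2sq_le f g : cmeasurable f -> cmeasurable g -> (forall x, normsq (f x) <= normsq (g x)) ->
  (L2sq f <= L2sq g)%E.
Proof.
move=> mf mg fg; apply: ge0_le_integral => //.
- by move=> x _; rewrite lee_fin normsq_ge0.
- exact: emeasurable_normsq.
- exact: emeasurable_normsq.
- by move=> x _; rewrite lee_fin.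
Qed.

Lemma L2sq_ae_eq f g : cmeasurable f -> cmeasurable g -> {ae mu, forall x, f x = g x} ->
  L2sq f = L2sq g.
Proof.
move=> mf mg fg; apply: ge0_ae_eq_integral => //.
- exact: emeasurable_normsq.
- exact: emeasurable_normsq.
- by move=> x _; rewrite lee_fin normsq_ge0.
- by move=> x _; rewrite lee_fin normsq_ge0.
- by apply: ae_imply fg => x -> _.
Qed.

Lemma L2D f g : L2 f -> L2 g -> L2 (fun x => f x + g x).
Proof.
move=> /L2P[mf f2] /L2P[mg g2]; apply/L2P; split; first exact: cmeasurableD.
apply: le_lt_trans (L2sqD_le _ _ mf mg) _.
by rewrite lte_mul_pinfty// lte_add_pinfty.
Qed.

Lemma L2Z f (c : C) : L2 f -> L2 (fun x => c * f x).
Proof.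
move=> /L2P[mf f2]; apply/L2P; split; first exact: cmeasurableZ.
by rewrite L2sqZ// lte_mul_pinfty// lee_fin normsq_ge0.
Qed.

Lemma L2B f g : L2 f -> L2 g -> L2 (fun x => f x - g x).
Proof.
move=> f2 g2; have := L2D _ _ f2 (L2Z _ (-1) g2).
by congr L2; apply/funext => x; rewrite mulN1r.
Qed.

Lemma L2_le f g : cmeasurable f -> L2 g -> (forall x, normsq (f x) <= normsq (g x)) -> L2 f.
Proof.
move=> mf /L2P[mg g2] fg; apply/L2P; split => //.
exact: le_lt_trans (L2sq_le _ _ mf mg fg) _.
Qed.

Lemma L2_ae_eq f g : cmeasurable g -> L2 f -> {ae mu, forall x, f x = g x} -> L2 g.
Proof.
move=> mg /L2P[mf f2] fg; apply/L2P; split => //.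
by rewrite -(L2sq_ae_eq _ _ mf mg fg).
Qed.

Definition cintegrable f :=
  mu.-integrable setT (EFin \o reF f) /\ mu.-integrable setT (EFin \o imF f).

Lemma integrable_normsq f : L2 f -> mu.-integrable setT (EFin \o (fun x => normsq (f x))).
Proof.
move=> /L2P[mf f2]; apply/integrableP; split; first exact: emeasurable_normsq.
by under eq_integral do rewrite /= ger0_norm ?normsq_ge0//.
Qed.

Lemma normsqMi (z : C) : normsq (z * 'i%C) = normsq z.
Proof. by rewrite normsqM [X in _ * X]/normsq /= expr0n expr1n add0r mulr1. Qed.

Lemma Im_Re (z : C) : Im z = - Re (z * 'i%C).
Proof. by rewrite ReM /= mulr0 mulr1 sub0r opprK. Qed.

Lemma cintegrable_L2M f g : L2 f -> L2 g -> cintegrable (fun x => f x * g x).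
Proof.
move=> f2 g2.
have [m1 m2] := cmeasurableM _ _ (L2_cmeasurable _ f2) (L2_cmeasurable _ g2).
have idom : mu.-integrable setT (EFin \o (fun x => normsq (f x) + normsq (g x))).
  by apply: integrableDR; exact: integrable_normsq.
split; apply: integrable_leR idom => // x.
- by have := norm_ReM_le 1 (f x) (g x) ltr01; rewrite invr1 !mul1r.
- rewrite /imF Im_Re normrN -mulrA.
  by have := norm_ReM_le 1 (f x) (g x * 'i%C) ltr01; rewrite normsqMi invr1 !mul1r.
Qed.

Lemma cintegralD f g : cintegrable f -> cintegrable g ->
  cintegral (fun x => f x + g x) = cintegral f + cintegral g.
Proof.
move=> [f1 f2] [g1 g2]; apply: complex_eq; rewrite ?(ReD, ImD) /=.
- rewrite -RintegralD//; apply: eq_Rintegral => x _; exact: ReD.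
- rewrite -RintegralD//; apply: eq_Rintegral => x _; exact: ImD.
Qed.

Lemma cintegralZ f (c : C) : cintegrable f ->
  cintegral (fun x => c * f x) = c * cintegral f.
Proof.
move=> [f1 f2]; apply: complex_eq; rewrite ?(ReM, ImM) /=.
- rewrite -!RintegralZl// -RintegralB//; [|exact: integrableZlR|exact: integrableZlR].
  by apply: eq_Rintegral => x _; exact: ReM.
- rewrite -!RintegralZl// -RintegralD//; [|exact: integrableZlR|exact: integrableZlR].
  by apply: eq_Rintegral => x _; exact: ImM.
Qed.

Lemma cintegrableD f g : cintegrable f -> cintegrable g -> cintegrable (fun x => f x + g x).
Proof.
move=> [f1 f2] [g1 g2]; split.
- rewrite (_ : _ \o _ = (EFin \o reF f) \+ (EFin \o reF g))%E; first exact: integrableD.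
  by apply/funext => x; rewrite /reF /= ReD.
- rewrite (_ : _ \o _ = (EFin \o imF f) \+ (EFin \o imF g))%E; first exact: integrableD.
  by apply/funext => x; rewrite /imF /= ImD.
Qed.

Lemma cintegrableZ f (c : C) : cintegrable f -> cintegrable (fun x => c * f x).
Proof.
move=> [f1 f2]; split.
- rewrite (_ : _ \o _ = (fun x => (Re c)%:E * (EFin \o reF f) x) \-
                        (fun x => (Im c)%:E * (EFin \o imF f) x))%E.
    by apply: integrableB => //; exact: integrableZl.
  by apply/funext => x; rewrite /reF /= ReM.
- rewrite (_ : _ \o _ = (fun x => (Re c)%:E * (EFin \o imF f) x) \+
                        (fun x => (Im c)%:E * (EFin \o reF f) x))%E.
    by apply: integrableD => //; exact: integrableZl.
  by apply/funext => x; rewrite /imF /= ImM.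
Qed.

Lemma cintegral_ae_eq f g : cmeasurable f -> cmeasurable g -> {ae mu, forall x, f x = g x} ->
  cintegral f = cintegral g.
Proof.
move=> [mf1 mf2] [mg1 mg2] fg; apply: complex_eq => /=; congr fine.
- apply: ae_eq_integral => //; [exact/measurable_EFinP|exact/measurable_EFinP|].
  by apply: ae_imply fg => x + _; rewrite /reF /= => ->.
- apply: ae_eq_integral => //; [exact/measurable_EFinP|exact/measurable_EFinP|].
  by apply: ae_imply fg => x + _; rewrite /imF /= => ->.
Qed.

Lemma Re_cintegral_le (t : R) f h : 0 < t -> L2 f -> L2 h ->
  `|Re (cintegral (fun x => f x * h x))| <=
     t^-1 * fine (L2sq f) + t * fine (L2sq h).
Proof.
move=> t0 f2 h2; have [i1 _] := cintegrable_L2M _ _ f2 h2.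
apply: le_trans (le_normr_Rintegral _ i1) _ => //.
have s1 := integrable_normsq _ f2; have s2 := integrable_normsq _ h2.
rewrite /L2sq -[fine _]/(Rintegral _ _ _) -[X in t * X]/(Rintegral _ _ _).
rewrite -!RintegralZl// -RintegralD//; [|exact: integrableZlR|exact: integrableZlR].
apply: le_Rintegral => //.
- exact: integrable_norm.
- by apply: integrableDR; apply: integrableZlR.
- by move=> x _; exact: norm_ReM_le.
Qed.


End square_integrable.

(** * Closed spans and continuity of the pairing *)

Section closures.
Context {R : realType}.
Local Notation C := R[i].
Local Notation mu := (@lebesgue_measure R).
Implicit Types (f g h : R -> C) (A B : set (R -> C)).

Lemma L2sq_subC f g : L2sq (fun x => f x - g x) = L2sq (fun x => g x - f x).
Proof. by rewrite /L2sq; under eq_integral do rewrite -normsqN opprB. Qed.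

Lemma L2closureP A f : A `<=` @L2 R -> L2closure A f <->
  L2 f /\ forall e : R, 0 < e -> exists2 g, A g & (L2sq (fun x => f x - g x)%R < e%:E)%E.
Proof.
move=> A2; split=> -[f2 h]; split => // e e0.
- have [|g Ag] := h (Num.sqrt e); first by rewrite sqrtr_gt0.
  by move/L2norm_lt; rewrite sqrtr_gt0 sqr_sqrtr ?ltW// => /(_ e0); exists g.
- have [|g Ag] := h (e ^+ 2); first by rewrite exprn_gt0.
  by move=> /L2norm_lt H; exists g => //; exact: H.
Qed.

Lemma sub_L2closure A : A `<=` @L2 R -> A `<=` L2closure A.
Proof.
move=> A2 f Af; apply/L2closureP => //; split; first exact: A2.
move=> e e0; exists f => //.
rewrite /L2sq; under eq_integral do rewrite subrr normsq0.
by rewrite integral0 lte_fin.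
Qed.

Lemma L2closure_lim A f : A `<=` @L2 R -> L2 f ->
  (forall e : R, 0 < e ->
     exists2 g, L2closure A g & (L2sq (fun x => f x - g x)%R < e%:E)%E) ->
  L2closure A f.
Proof.
move=> A2 f2 h; apply/L2closureP => //; split => // e e0.
have e40 : 0 < e / 4 by rewrite divr_gt0.
have [g /(L2closureP _ _ A2)[g2 /(_ _ e40)[k Ak gk]] fg] := h _ e40.
exists k => //.
have -> : (fun x => f x - k x) = fun x => (f x - g x) + (g x - k x).
  by apply/funext => x; rewrite addrA subrK.
have mf := L2_cmeasurable _ f2; have mg := L2_cmeasurable _ g2.
have mk := L2_cmeasurable _ (A2 _ Ak).
apply: le_lt_trans (L2sqD_le _ _ (cmeasurableB _ _ mf mg) (cmeasurableB _ _ mg mk)) _.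
have -> : e%:E = (2%:E * ((e / 4)%:E + (e / 4)%:E))%E.
  by rewrite -EFinD -EFinM; congr EFin; field.
by rewrite lte_pmul2l// lteD.
Qed.

Lemma L2closure_ae A f g : A `<=` @L2 R -> cmeasurable g ->
  {ae mu, forall x, f x = g x} -> L2closure A f -> L2closure A g.
Proof.
move=> A2 mg fg Af; have /(L2closureP _ _ A2)[f2 _] := Af.
apply: L2closure_lim => //; first exact: L2_ae_eq fg.
move=> e e0; exists f => //.
rewrite (L2sq_ae_eq _ (fun=> 0)).
- by rewrite /L2sq; under eq_integral do rewrite normsq0; rewrite integral0 lte_fin.
- by apply: cmeasurableB => //; exact: L2_cmeasurable.
- exact: cmeasurable_cst.
- by apply: ae_imply fg => x ->; rewrite subrr.
Qed.

Lemma L2closureD A f g : A `<=` @L2 R ->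
  (forall a b, A a -> A b -> A (fun x => a x + b x)) ->
  L2closure A f -> L2closure A g -> L2closure A (fun x => f x + g x).
Proof.
move=> A2 AD /(L2closureP _ _ A2)[f2 hf] /(L2closureP _ _ A2)[g2 hg].
apply/L2closureP => //; split; first exact: L2D.
move=> e e0; have e40 : 0 < e / 4 by rewrite divr_gt0.
have [f' Af' ff'] := hf _ e40; have [g' Ag' gg'] := hg _ e40.
exists (fun x => f' x + g' x); first exact: AD.
have -> : (fun x => f x + g x - (f' x + g' x)) =
          fun x => (f x - f' x) + (g x - g' x).
  by apply/funext => x; rewrite opprD addrACA.
have mf := L2_cmeasurable _ (L2B _ _ f2 (A2 _ Af')).
have mg := L2_cmeasurable _ (L2B _ _ g2 (A2 _ Ag')).
apply: le_lt_trans (L2sqD_le _ _ mf mg) _.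
have -> : e%:E = (2%:E * ((e / 4)%:E + (e / 4)%:E))%E.
  by rewrite -EFinD -EFinM; congr EFin; field.
by rewrite lte_pmul2l// lteD.
Qed.

Lemma L2closureZ A f (c : C) : A `<=` @L2 R ->
  (forall (d : C) a, A a -> A (fun x => d * a x)) ->
  L2closure A f -> L2closure A (fun x => c * f x).
Proof.
move=> A2 AZ /(L2closureP _ _ A2)[f2 hf].
apply/L2closureP => //; split; first exact: L2Z.
move=> e e0.
have c0 : 0 < normsq c + 1 by rewrite ltr_wpDl ?normsq_ge0.
have [|f' Af' ff'] := hf (e / (normsq c + 1)); first by rewrite divr_gt0.
exists (fun x => c * f' x); first exact: AZ.
have -> : (fun x => c * f x - c * f' x) = fun x => c * (f x - f' x).
  by apply/funext => x; rewrite mulrBr.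
have m := L2_cmeasurable _ (L2B _ _ f2 (A2 _ Af')).
rewrite L2sqZ//.
have -> : e%:E = ((normsq c + 1)%:E * (e / (normsq c + 1))%:E)%E.
  by rewrite -EFinM; congr EFin; field; rewrite gt_eqF.
apply: (@le_lt_trans _ _ ((normsq c + 1)%:E * L2sq (fun x => f x - f' x)%R)%E).
  by apply: lee_wpmul2r; [exact: L2sq_ge0|rewrite lee_fin lerDl].
by rewrite lte_pmul2l.
Qed.

Lemma cspan_base B b : B b -> cspan B b.
Proof.
move=> Bb; exists 1%N, (fun=> 1), (fun=> b); split => //.
by apply/funext => x; rewrite big_ord1 mul1r.
Qed.

Lemma cspan_L2 B : B `<=` @L2 R -> cspan B `<=` @L2 R.
Proof.
move=> B2 _ [n [c [b [Bb ->]]]].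
elim: n c b Bb => [|n IH] c b Bb.
  under eq_fun do rewrite big_ord0.
  apply/L2P; split; first exact: cmeasurable_cst.
  by rewrite /L2sq; under eq_integral do rewrite normsq0; rewrite integral0.
under eq_fun do rewrite big_ord_recl.
apply: L2D; first by apply: L2Z; exact: B2.
exact: IH.
Qed.

Lemma cspanD B f g : cspan B f -> cspan B g -> cspan B (fun x => f x + g x).
Proof.
move=> [n [c [b [Bb ->]]]] [m [d [k [Bk ->]]]].
exists (n + m)%N,
  (fun i : 'I_(n + m) => match fintype.split i with inl j => c j | inr j => d j end),
  (fun i : 'I_(n + m) => match fintype.split i with inl j => b j | inr j => k j end); split.
  by move=> i; case: fintype.split.
apply/funext => x; rewrite big_split_ord /=; congr (_ + _); apply: eq_bigr => i _.
- have -> : fintype.split (lshift m i) = inl i by exact: (unsplitK (inl i)).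
  by [].
- have -> : fintype.split (rshift n i) = inr i by exact: (unsplitK (inr i)).
  by [].
Qed.

Lemma cspanZ B f (a : C) : cspan B f -> cspan B (fun x => a * f x).
Proof.
move=> [n [c [b [Bb ->]]]]; exists n, (fun i => a * c i), b; split => //.
by apply/funext => x; rewrite mulr_sumr; apply: eq_bigr => i _; rewrite mulrA.
Qed.

(** In the weighted inequality [Re_cintegral_le], the weight is first taken
small so that the term in [h] is negligible, then [f] is approximated in [A]
to a precision that depends on the weight. *)
Lemma pairing_L2closure A f h : A `<=` @L2 R -> L2 h -> L2closure A f ->
  (forall g, A g -> cintegral (fun x => g x * h x) = 0) ->
  cintegral (fun x => f x * h x) = 0.
Proof.
move=> A2 h2 /(L2closureP _ _ A2)[f2 Af] A0.
have H0 : 0 <= fine (L2sq h) by rewrite fine_ge0// L2sq_ge0.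
have key (k : R -> C) : L2 k -> (forall g, A g -> cintegral (fun x => g x * k x) = 0) ->
    Re (cintegral (fun x => f x * k x)) = 0.
  move=> k2 Ak; apply/eqP; rewrite -normr_le0; apply/ler_addgt0Pl => e e0.
  rewrite addr0.
  have K0 : 0 < fine (L2sq k) + 1 by rewrite ltr_wpDl// fine_ge0// L2sq_ge0.
  (* [t] makes the term in [k] at most [e / 2]; the precision [t * (e / 2)]
     required from [g] then bounds the other term by [e / 2]. *)
  pose t := e / 2 / (fine (L2sq k) + 1).
  have t0 : 0 < t by rewrite !divr_gt0.
  have [|g Ag] := Af (t * (e / 2)); first by rewrite mulr_gt0// divr_gt0.
  have d2 := L2B _ _ f2 (A2 _ Ag); move=> fg.
  have -> : cintegral (fun x => f x * k x) = cintegral (fun x => (f x - g x) * k x).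
    rewrite (_ : (fun x => (f x - g x) * k x) = fun x => f x * k x + (-1) * (g x * k x)).
      rewrite cintegralD; [|exact: cintegrable_L2M|].
        rewrite cintegralZ; last by apply: cintegrable_L2M => //; exact: A2.
        by rewrite (Ak g)// mulr0 addr0.
      by apply: cintegrableZ; apply: cintegrable_L2M => //; exact: A2.
    by apply/funext => x; rewrite mulN1r mulrBl.
  apply: le_trans (Re_cintegral_le _ _ _ t0 d2 k2) _.
  have -> : e = t^-1 * (t * (e / 2)) + t * (fine (L2sq k) + 1).
    rewrite /t; field.
    by rewrite !gt_eqF.
  apply: lerD.
    apply: ler_wpM2l; first by rewrite invr_ge0 ltW.
    rewrite -lee_fin fineK; first exact: ltW.
    by rewrite ge0_fin_numE ?L2sq_ge0//; have /L2P[] := d2.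
  by rewrite ler_wpM2l ?lerDl// ltW.
apply: complex_eq; first exact: key.
rewrite Im_Re.
have i2 : L2 (fun x => 'i%C * h x) by exact: L2Z.
have mi g : L2 g -> cintegral (fun x => g x * ('i%C * h x)) =
                    cintegral (fun x => g x * h x) * 'i%C.
  move=> g2; rewrite mulrC -cintegralZ; last exact: cintegrable_L2M.
  by congr cintegral; apply/funext => x; rewrite mulrCA.
rewrite -mi// key ?oppr0// => g Ag.
by rewrite mi ?A0 ?mul0r//; exact: A2.
Qed.

Lemma L2sq_dominated (fn : nat -> R -> C) f (H : R -> R) :
  (forall n, cmeasurable (fn n)) -> cmeasurable f -> mu.-integrable setT (EFin \o H) ->
  (forall n x, normsq (fn n x - f x) <= H x) ->
  {ae mu, forall x, normsq (fn n x - f x) @[n --> \oo] --> (0 : R)} ->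
  forall e : R, 0 < e -> exists n, (L2sq (fun x => f x - fn n x)%R < e%:E)%E.
Proof.
move=> mfn mf iH bH cv e e0.
have mE n : measurable_fun setT (fun x => (normsq (fn n x - f x)%R)%:E : \bar R).
  by apply: emeasurable_normsq; exact: cmeasurableB.
have [|||||_ _] := @dominated_convergence _ _ R mu setT measurableT
   (fun n x => (normsq (fn n x - f x)%R)%:E) (cst 0%E) (EFin \o H) _ _ _ _ _.
- by move=> n; exact: mE.
- exact: measurable_cst.
- apply: ae_imply cv => x cx _; apply/fine_cvgP; split => /=; first exact: nearW.
  by [].
- exact: iH.
- by apply: aeW => x n _ /=; rewrite lee_fin ger0_norm ?normsq_ge0.
- rewrite integral0 => /fine_cvgP[fin /cvgr_lt /(_ _ e0) lte].
  near \oo => n; exists n; rewrite L2sq_subC -[ltLHS]fineK ?lte_fin.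
    by near: n.
  by near: n.
Unshelve. all: end_near. Qed.

End closures.

(** * Integrals over the line *)

Section integration.
Context {R : realType}.
Local Notation C := R[i].
Local Notation mu := (@lebesgue_measure R).
Implicit Types (f g h : R -> C) (w : C).

Lemma ae_neq (c : R) : {ae mu, forall x, x != c}.
Proof.
exists [set c]; split => //; first exact: lebesgue_measure_set1.
by move=> x /= /negP; rewrite negbK => /eqP.
Qed.

(** The integrand is left free at [a] and [b], where the functions of interest
jump. *)
Lemma Rintegral_FTC (F f h : R -> R) (a b : R) : a < b ->
  (forall x, is_derive x (1 : R) F (f x)) -> continuous f ->
  measurable_fun setT h ->
  (forall x, a < x < b -> h x = f x) ->
  (forall x, (x < a) || (b < x) -> h x = 0) ->
  (\int[mu]_x h x)%R = F b - F a.
Proof.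
move=> ab dF cf mh hin hout.
have cF x : {for x, continuous F}.
  by apply/differentiable_continuous/derivable1_diffP; have [] := dF x.
have mf : measurable_fun setT f by exact: continuous_measurable_fun.
have := @continuous_FTC2 R f F a b ab.
move=> /(_ (continuous_subspaceT cf)) FTC.
rewrite /Rintegral (_ : \int[mu]_x (h x)%:E = (F b - F a)%:E)%E//.
rewrite EFinB -FTC; last 2 first.
- split; first by move=> x _; have [] := dF x.
    exact/cvg_at_right_filter/cF.
  exact/cvg_at_left_filter/cF.
- by move=> x _; rewrite derive1E; have [_ ->] := dF x.
rewrite [RHS]integral_mkcond; apply: ae_eq_integral => //.
- exact/measurable_EFinP.
- apply/(measurable_restrictT _ _).1 => //; apply/measurable_EFinP.
  exact: measurable_funTS.
- apply: ae_imply (ae_and _ _ (ae_neq a) (ae_neq b)) => x [xa xb] _.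
  rewrite patchE; case: ifPn => [|]; rewrite ?inE ?notin_setE /= in_itv/=.
    by move=> /andP[ax xb']; rewrite hin// !lt_neqAle eq_sym xa ax xb.
  by move=> /negP; rewrite negb_and -!ltNge => /hout ->.
Qed.

Lemma cintegral_FTC (F f h : R -> C) (a b : R) : a < b ->
  (forall x, is_cder F x (f x)) ->
  continuous (reF f) /\ continuous (imF f) -> cmeasurable h ->
  (forall x, a < x < b -> h x = f x) ->
  (forall x, (x < a) || (b < x) -> h x = 0) ->
  cintegral h = F b - F a.
Proof.
move=> ab dF [cf1 cf2] [mh1 mh2] hin hout; apply: complex_eq.
- rewrite ReD ReN /=; apply: (Rintegral_FTC (reF F) (reF f)) => //.
  + by move=> x; have [] := dF x.
  + by move=> x /hin; rewrite /reF => ->.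
  + by move=> x /hout; rewrite /reF => ->.
- rewrite ImD ImN /=; apply: (Rintegral_FTC (imF F) (imF f)) => //.
  + by move=> x; have [] := dF x.
  + by move=> x /hin; rewrite /imF => ->.
  + by move=> x /hout; rewrite /imF => ->.
Qed.

Lemma integrable_csupp (f : R -> R) (a b : R) : continuous f ->
  (forall x, (x < a) || (b < x) -> f x = 0) -> mu.-integrable setT (EFin \o f).
Proof.
move=> cf f0.
have : mu.-integrable `[a, b] (EFin \o f).
  apply: continuous_compact_integrable; first exact: segment_compact.
  exact: continuous_subspaceT.
have [h _] := @integrable_mkcond _ _ _ mu `[a, b]%classic (EFin \o f) (measurable_itv _).
move=> /h.
congr (integrable _ _ _); apply/funext => x; rewrite patchE.
case: ifPn => //; rewrite notin_setE /= in_itv /=.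
by move=> /negP; rewrite negb_and -!ltNge => /f0 ->.
Qed.

Lemma L2_csupp f (a b : R) : continuous (reF f) /\ continuous (imF f) ->
  (forall x, (x < a) || (b < x) -> f x = 0) -> L2 f.
Proof.
move=> cf f0; apply/L2P; split; first exact: cmeasurable_continuous.
have : mu.-integrable setT (EFin \o (fun x => normsq (f x))).
  apply: (@integrable_csupp _ a b); last by move=> x /f0 ->; exact: normsq0.
  have [c1 c2] := cf => x.
  by apply: cvgD; rewrite expr2; apply: cvgM; [exact: c1|exact: c1|exact: c2|exact: c2].
move=> /integrableP[_]; apply: le_lt_trans.
apply: ge0_le_integral => //.
- by move=> x _; rewrite lee_fin normsq_ge0.
- by apply: emeasurable_normsq; exact: cmeasurable_continuous.
- apply/measurableT_comp => //; apply: emeasurable_normsq; exact: cmeasurable_continuous.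
- by move=> x _ /=; rewrite lee_fin ler_norm.
Qed.

Lemma integrable_expR_abs (s : R) : 0 < s ->
  mu.-integrable setT (EFin \o (fun x => expR (- s * `|x|))).
Proof.
move=> s0.
have cE : continuous (fun x : R => expR (- s * `|x|)).
  move=> x; apply: continuous_comp; last exact: continuous_expR.
  by apply: continuousM; [exact: cst_continuous|exact: norm_continuous].
apply/integrableP; split.
  by apply/measurable_EFinP; exact: continuous_measurable_fun.
under eq_integral do rewrite /= ger0_norm ?expR_ge0//.
rewrite ge0_symfun_integralT//; last by move=> x /=; rewrite normrN.
rewrite lte_mul_pinfty//.
apply: (@le_lt_trans _ _ (\int[mu]_(x in [set x | (0 <= x)%R]) (s^-1 * exponential_pdf s x)%:E)%E).
  apply: ge0_le_integral => //=.
  - by rewrite -set_itvcy.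
  - apply/measurable_EFinP; apply: measurable_funTS.
    exact: continuous_measurable_fun.
  - apply/measurable_EFinP/measurable_funTS; apply: measurable_funM => //.
    exact: measurable_exponential_pdf.
  - move=> x x0; rewrite lee_fin exponential_pdfE//.
    by rewrite mulrA mulVf ?gt_eqF// mul1r ger0_norm.
apply: (@le_lt_trans _ _ (\int[mu]_x (s^-1 * exponential_pdf s x)%:E)%E).
  apply: ge0_subset_integral => //=.
  - by rewrite -set_itvcy.
  - apply/measurable_EFinP; apply: measurable_funM => //.
    exact: measurable_exponential_pdf.
  - by move=> x _; rewrite lee_fin mulr_ge0 ?invr_ge0 ?exponential_pdf_ge0 ?ltW.
have i := integrableZlR s^-1 _ (integrable_exponential_pdf s0).
exact: (integrable_lty measurableT i).
Qed.

Lemma L2_exp_decay f (s K : R) : 0 < s -> cmeasurable f ->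
  (forall x, normsq (f x) <= K * expR (- s * `|x|)) -> L2 f.
Proof.
move=> s0 mf fK; apply/L2P; split => //.
have i := integrableZlR K _ (integrable_expR_abs s s0).
apply: (@le_lt_trans _ _ (\int[mu]_x (K * expR (- s * `|x|))%:E)%E); last first.
  exact: integrable_lty i.
apply: ge0_le_integral => //.
- by move=> x _; rewrite lee_fin normsq_ge0.
- exact: emeasurable_normsq.
- by have /integrableP[] := i.
- by move=> x _ /=; rewrite lee_fin.
Qed.

End integration.

(** * Half-line exponentials *)

Section free_green_function.
Context {R : realType}.
Local Notation C := R[i].
Local Notation mu := (@lebesgue_measure R).
Implicit Types (f g h u : R -> C) (w : C).

(** With [Re w < 0], [exp_right] and [exp_left] are the solutions of
[u'' = w^2 u] that decay at infinity on the two half-lines issued from [c],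
extended by zero. Translates of the Green function and of its derivative are,
off [c], combinations of the two. *)
Definition exp_right w c (x : R) : C := if c < x then wexp w (x - c) else 0.
Definition exp_left w c (x : R) : C := if x < c then wexp w (c - x) else 0.

Lemma normsq_wexp w x : normsq (wexp w x) = expR (2 * (Re w * x)).
Proof. by rewrite normsqE normc_wexp -expRM_natl. Qed.

Lemma is_cder_wexp_shift w c (x : R) :
  is_cder (fun y => wexp w (y - c)) x (w * wexp w (x - c)).
Proof.
have -> : (fun y => wexp w (y - c)) = fun y => wexp w (- c) * wexp w y.
  by apply/funext => y; rewrite wexpD mulrC.
apply: is_cder_eq; first by apply: is_cderZ; exact: is_cder_wexp.
by rewrite wexpD; ring.
Qed.

Lemma is_cder_wexp_rev w c (x : R) :
  is_cder (fun y => wexp w (c - y)) x (- w * wexp w (c - x)).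
Proof.
have -> : (fun y => wexp w (c - y)) = fun y => wexp (- w) (y - c).
  by apply/funext => y; rewrite wexpN opprB.
by rewrite -opprB -wexpN; exact: is_cder_wexp_shift.
Qed.

Lemma cmeasurable_wexp_shift w c : cmeasurable (fun y => wexp w (y - c)).
Proof.
apply: cmeasurable_continuous; apply: (cder_continuous _ (fun y => w * wexp w (y - c))) => x.
exact: is_cder_wexp_shift.
Qed.

Lemma cmeasurable_wexp_rev w c : cmeasurable (fun y => wexp w (c - y)).
Proof.
apply: cmeasurable_continuous; apply: (cder_continuous _ (fun y => - w * wexp w (c - y))) => x.
exact: is_cder_wexp_rev.
Qed.

Lemma cmeasurable_exp_right w c : cmeasurable (exp_right w c).
Proof.
apply: cmeasurable_if; [|exact: cmeasurable_wexp_shift|exact: cmeasurable_cst].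
exact: measurable_fun_ltr.
Qed.

Lemma cmeasurable_exp_left w c : cmeasurable (exp_left w c).
Proof.
apply: cmeasurable_if; [|exact: cmeasurable_wexp_rev|exact: cmeasurable_cst].
exact: measurable_fun_ltr.
Qed.

Lemma expR_shift_le w c (x : R) : Re w < 0 ->
  expR (2 * (Re w * `|x - c|)) <=
  expR (- 2 * (Re w * `|c|)) * expR (- (- 2 * Re w) * `|x|).
Proof.
move=> w0; rewrite -expRD ler_expR.
have h : `|x| <= `|x - c| + `|c| by rewrite -[x in leLHS](subrK c) ler_normD.
nra.
Qed.

Lemma L2_shift_bound w c f : Re w < 0 -> cmeasurable f ->
  (forall x, normsq (f x) <= expR (2 * (Re w * `|x - c|))) -> L2 f.
Proof.
move=> w0 mf fle.
apply: (L2_exp_decay _ (- 2 * Re w) (expR (- 2 * (Re w * `|c|)))) => //.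
  by rewrite mulNr oppr_gt0 pmulr_rlt0.
by move=> x; apply: le_trans (fle x) _; exact: expR_shift_le.
Qed.

Lemma L2_exp_right w c : Re w < 0 -> L2 (exp_right w c).
Proof.
move=> w0; apply: (L2_shift_bound w c) => //; first exact: cmeasurable_exp_right.
move=> x; rewrite /exp_right; case: ifP => [cx|_]; last by rewrite normsq0 expR_ge0.
by rewrite normsq_wexp gtr0_norm// subr_gt0.
Qed.

Lemma L2_exp_left w c : Re w < 0 -> L2 (exp_left w c).
Proof.
move=> w0; apply: (L2_shift_bound w c) => //; first exact: cmeasurable_exp_left.
move=> x; rewrite /exp_left; case: ifP => [cx|_]; last by rewrite normsq0 expR_ge0.
by rewrite normsq_wexp distrC gtr0_norm// subr_gt0.
Qed.

Definition supp_in (a b : R) u := forall x, (x < a) || (b < x) -> u x = 0.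

Lemma supp_in_cderive a b u : supp_in a b u -> supp_in a b (cderive u).
Proof.
move=> u0 x xab; apply: is_cderE.
apply: near_is_cder (is_cder_cst 0 x).
case/orP: xab => [xa|bx]; near=> y; rewrite u0//.
- by apply/orP; left; near: y; exact: lt_nbhsl.
- by apply/orP; right; near: y; exact: lt_nbhsr.
Unshelve. all: end_near. Qed.

(** Factored as [(D - w) (D + w) u]; this is minus [(L - z) u] when
[w ^+ 2 = - z]. *)
Definition helmholtz w u : R -> C := fun x => cderive (cderive u) x - w ^+ 2 * u x.

Lemma csmooth_helmholtz w u : csmooth u -> csmooth (helmholtz w u).
Proof.
move=> su; have [su' _] := csmooth_cderive _ su.
have [su'' _] := csmooth_cderive _ su'.
exact: (csmoothB _ _ su'' (csmoothZ _ _ su)).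
Qed.

Lemma supp_in_helmholtz w a b u : supp_in a b u -> supp_in a b (helmholtz w u).
Proof.
move=> u0 x xab; rewrite /helmholtz u0// mulr0 subr0.
by rewrite (supp_in_cderive a b _ (supp_in_cderive a b _ u0)).
Qed.

(** The integrand has the primitive [e^(w (x - c)) (u' - w u)] on the half-line,
so only the values of [u] and [u'] at [c] survive. *)
Lemma cintegral_exp_right w c a b u : csmooth u -> supp_in a b u ->
  cintegral (fun x => exp_right w c x * helmholtz w u x) = w * u c - cderive u c.
Proof.
move=> su u0; have [su' du] := csmooth_cderive _ su.
have [su'' du'] := csmooth_cderive _ su'.
pose F x := wexp w (x - c) * (cderive u x - w * u x).
(* Beyond [M] the function [u] and its derivative vanish. *)
pose M := Num.max b c + 1.
have cM : c < M by rewrite ltr_pwDr// le_max lexx orbT.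
have bM : b < M by rewrite ltr_pwDr// le_max lexx.
have sexs : csmooth (fun x => wexp w (x - c)).
  have -> : (fun y => wexp w (y - c)) = fun y => wexp w (- c) * wexp w y.
    by apply/funext => y; rewrite wexpD mulrC.
  by apply: csmoothZ; exact: csmooth_wexp.
have sfw := csmoothM _ _ sexs (csmooth_helmholtz w _ su).
rewrite (cintegral_FTC F (fun x => wexp w (x - c) * helmholtz w u x) _ c M cM).
- by rewrite /F u0 ?bM ?orbT// (supp_in_cderive a b _ u0) ?bM ?orbT// subrr wexp0; ring.
- move=> x; apply: is_cder_eq.
    apply: is_cderM; first exact: is_cder_wexp_shift.
    by apply: is_cderB; [exact: du'|apply: is_cderZ; exact: du].
  by rewrite /helmholtz; ring.
- exact: (csmooth_continuous _ sfw).
- apply: cmeasurableM; first exact: cmeasurable_exp_right.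
  by apply: cmeasurable_csmooth; exact: csmooth_helmholtz.
- by move=> x /andP[cx _]; rewrite /exp_right cx.
- move=> x /orP[xc|Mx]; rewrite /exp_right; first by rewrite ltNge (ltW xc) mul0r.
  by rewrite (supp_in_helmholtz w a b _ u0) ?mulr0// (lt_trans bM Mx) orbT.
Qed.

(** Mirror image of [cintegral_exp_right], with the primitive
[e^(w (c - x)) (u' + w u)]. *)
Lemma cintegral_exp_left w c a b u : csmooth u -> supp_in a b u ->
  cintegral (fun x => exp_left w c x * helmholtz w u x) = w * u c + cderive u c.
Proof.
move=> su u0; have [su' du] := csmooth_cderive _ su.
have [su'' du'] := csmooth_cderive _ su'.
pose F x := wexp w (c - x) * (cderive u x + w * u x).
pose M := Num.min a c - 1.
have cM : M < c by rewrite ltrBlDr ltr_pwDr// ge_min lexx orbT.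
have aM : M < a by rewrite ltrBlDr ltr_pwDr// ge_min lexx.
have sexs : csmooth (fun x => wexp w (c - x)).
  have -> : (fun y => wexp w (c - y)) = fun y => wexp w c * wexp (- w) y.
    by apply/funext => y; rewrite wexpD wexpN.
  by apply: csmoothZ; exact: csmooth_wexp.
have sfw := csmoothM _ _ sexs (csmooth_helmholtz w _ su).
rewrite (cintegral_FTC F (fun x => wexp w (c - x) * helmholtz w u x) _ M c cM).
- by rewrite /F [u M]u0 ?aM// [cderive u M](supp_in_cderive a b _ u0) ?aM// subrr wexp0; ring.
- move=> x; apply: is_cder_eq.
    apply: is_cderM; first exact: is_cder_wexp_rev.
    by apply: is_cderD; [exact: du'|apply: is_cderZ; exact: du].
  by rewrite /helmholtz; ring.
- exact: (csmooth_continuous _ sfw).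
- apply: cmeasurableM; first exact: cmeasurable_exp_left.
  by apply: cmeasurable_csmooth; exact: csmooth_helmholtz.
- by move=> x /andP[_ cx]; rewrite /exp_left cx.
- move=> x /orP[xM|cx]; rewrite /exp_left; last by rewrite ltNge (ltW cx) mul0r.
  by rewrite (supp_in_helmholtz w a b _ u0) ?mulr0// (lt_trans xM aM).
Qed.

End free_green_function.

(** * Primitives of compactly supported functions *)

Section primitives.
Context {R : realType}.
Local Notation C := R[i].
Local Notation mu := (@lebesgue_measure R).
Implicit Types (f g h u : R -> C).

Lemma real_primitive (f : R -> R) (a b : R) : continuous f ->
  (forall x, (x < a) || (b < x) -> f x = 0) ->
  exists F : R -> R, [/\ forall x, is_derive x (1 : R) F (f x),
    forall x, x < a -> F x = 0 &
    forall x, b < x -> F x = (\int[mu]_t f t)%R].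
Proof.
move=> cf f0; have fi := integrable_csupp _ _ _ cf f0.
exists (fun x => \int[mu]_(t in `]-oo, x]) f t)%R; split.
- move=> x.
  have xx1 : x < x + 1 by rewrite ltrDl.
  have fi1 : mu.-integrable `]-oo, (x + 1)] (EFin \o f) by apply: integrableS fi.
  have Nx : ((-oo%O : itv_bound R) < BRight x)%E by exact: ltNyr.
  have [dF F'] := continuous_FTC1 xx1 fi1 Nx (cf x).
  by rewrite -F' derive1E; exact: derivableP.
- move=> x xa.
  have -> : (\int[mu]_(t in `]-oo, x]) f t = \int[mu]_(t in `]-oo, x]) cst 0 t)%R.
    apply: eq_Rintegral => t; rewrite inE /= in_itv /= => tx.
    by apply: f0; rewrite (le_lt_trans tx).
  by rewrite Rintegral_cst ?mul0r.
- move=> x bx; rewrite Rintegral_mkcond; apply: eq_Rintegral => t _.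
  rewrite patchE; case: ifPn => //; rewrite notin_setE /= in_itv /= => /negP.
  by rewrite -ltNge => xt; rewrite f0// (lt_trans bx xt) orbT.
Qed.

Lemma csmooth_primitive h a b : csmooth h -> supp_in a b h ->
  exists P, [/\ csmooth P, forall x, is_cder P x (h x),
    forall x, x < a -> P x = 0 & forall x, b < x -> P x = cintegral h].
Proof.
move=> sh h0; have [c1 c2] := csmooth_continuous _ sh.
have [F [dF F0 F1]] : exists F : R -> R, [/\ forall x, is_derive x (1 : R) F (reF h x),
    forall x, x < a -> F x = 0 & forall x, b < x -> F x = (\int[mu]_t reF h t)%R].
  by apply: real_primitive => // x /h0; rewrite /reF => ->.
have [K [dK K0 K1]] : exists F : R -> R, [/\ forall x, is_derive x (1 : R) F (imF h x),
    forall x, x < a -> F x = 0 & forall x, b < x -> F x = (\int[mu]_t imF h t)%R].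
  by apply: real_primitive => // x /h0; rewrite /imF => ->.
pose P x := (F x +i* K x)%C.
have dP x : is_cder P x (h x) by split; [exact: dF|exact: dK].
exists P; split.
- exact: csmoothS dP.
- exact: dP.
- by move=> x xa; rewrite /P F0// K0.
- by move=> x bx; rewrite /P F1// K1.
Qed.

Lemma supp_in_bump (c d k : R) : 0 < k -> supp_in c d (fun x => (bump c d k x)%:C%C).
Proof.
move=> k0 x h; rewrite bump_out//.
by rewrite negb_and -!leNgt; case/orP: h => /ltW ->; rewrite ?orbT.
Qed.

(** A primitive of the bump is nondecreasing, and increases strictly across the
interval where the bump is positive. *)
Lemma cintegral_bump_neq0 (c d : R) : c < d ->
  cintegral (fun x => (bump c d 1 x)%:C%C) != 0.
Proof.
move=> cd; have k0 : (0 : R) < 1 by [].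
have [P [sP dP P0 P1]] := csmooth_primitive _ c d (csmooth_bump c d 1) (supp_in_bump c d 1 k0).
have cP := (csmooth_continuous _ sP).1.
have ReP x : is_derive x (1 : R) (reF P) (bump c d 1 x) by have [] := dP x.
have c1d1 : c - 1 < d + 1 by lra.
have mono (x y : R) : x <= y -> reF P x <= reF P y.
  rewrite le_eqVlt => /predU1P[->//|xy].
  have [|t _] := @MVT R (reF P) (bump c d 1) x y xy (fun t _ => ReP t).
    exact: continuous_subspaceT.
  move=> e; rewrite -subr_ge0 e mulr_ge0 ?bump_ge0// subr_ge0 ltW//.
have lt : reF P c < reF P d.
  have [|t /[!in_itv]/= tcd] := @MVT R (reF P) (bump c d 1) c d cd (fun t _ => ReP t).
    exact: continuous_subspaceT.
  by move=> e; rewrite -subr_gt0 e mulr_gt0 ?bump_gt0// subr_gt0.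
apply/eqP => I0.
have : reF P (d + 1) = 0 by rewrite /reF P1 ?I0// ltrDl.
have : reF P (c - 1) = 0 by rewrite /reF P0// gtrDl oppr_lt0.
have := mono (c - 1) c; have := mono d (d + 1); lra.
Qed.

End primitives.

(** * Test functions off a closed set *)

Section test_functions.
Context {R : realType}.
Local Notation C := R[i].
Implicit Types (f g h u : R -> C) (G : set R).

Lemma Cc_infty_itv G a b u : csmooth u -> supp_in a b u ->
  `[a, b] `<=` ~` G -> Cc_infty G u.
Proof.
move=> su u0 abG.
have sub : closure [set x | u x != 0] `<=` `[a, b]%classic.
  have /closure_id -> : closed (`[a, b]%classic : set R) by exact: itv_closed.
  apply: closureS => x /= ux; rewrite in_itv /= leNgt [x <= b]leNgt -negb_or.
  by apply: contra ux => /u0 ->.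
split; first exact: su.
- by apply: subclosed_compact sub; [exact: closed_closure|exact: segment_compact].
- exact: subset_trans abG.
Qed.

Lemma Cc_infty_supp G u : Cc_infty G u -> exists a b, supp_in a b u.
Proof.
move=> [_ /compact_bounded[M [_ HM]] _].
have {}HM := HM (M + 1); exists (- (M + 1)), (M + 1) => x h.
apply/eqP; apply: contraTT isT => ux.
have cux : closure [set x | u x != 0] x by apply: subset_closure.
have := HM _ x cux; rewrite ltrDl => /(_ ltr01).
by rewrite /globally /= ler_norml leNgt [x <= _]leNgt -negb_or h.
Qed.

Lemma Cc_infty_zero G u c : Cc_infty G u -> G c -> u c = 0 /\ cderive u c = 0.
Proof.
move=> [_ _ suG] Gc.
have nc : ~ closure [set x | u x != 0] c by move=> /suG.
have u0 : \forall x \near c, u x = 0.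
  have oc : open (~` closure [set x | u x != 0]) by apply: closed_openC; exact: closed_closure.
  have : nbhs c (~` closure [set x | u x != 0]) by apply: open_nbhs_nbhs.
  apply: filterS => x nx; apply/eqP; apply: contraPT nx => ux.
  by apply; exact: subset_closure.
split; first exact: nbhs_singleton u0.
apply: is_cderE; apply: near_is_cder (is_cder_cst 0 c).
by near=> x; apply/esym; near: x.
Unshelve. all: end_near. Qed.

Lemma Cc_infty_conj G u : Cc_infty G u -> Cc_infty G (fun x => (u x)^*%C).
Proof.
move=> [su cu uG]; rewrite /Cc_infty /=.
have -> : [set x | (u x)^*%C != 0] = [set x | u x != 0].
  by apply/funext => x /=; rewrite conjc_eq0.
by split; [exact: csmooth_conj|exact: cu|exact: uG].
Qed.

End test_functions.

(** * The deficiency subspace *)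

Section deficiency.
Context {R : realType}.
Local Notation C := R[i].
Local Notation mu := (@lebesgue_measure R).
Implicit Types (f g h u : R -> C) (G : set R).
Context (z : C) (z0 : ~~ (0 <= z)).

(** The exponent for which [g_z x] is a multiple of [e^(w |x|)]. *)
Definition decay_exp : C := 'i%C * sqrtC z.

Lemma decay_exp_sqr : decay_exp ^+ 2 = - z.
Proof. by rewrite /decay_exp exprMn sqr_i sqrtCK mulN1r. Qed.

Lemma Re_decay_exp_lt0 : Re decay_exp < 0.
Proof.
have [_ h] := sqrtC_Im_gt0 z0.
by rewrite /decay_exp ReM /= mul0r mul1r sub0r oppr_lt0.
Qed.

Lemma decay_exp_neq0 : decay_exp != 0.
Proof. by apply/eqP => e; have := Re_decay_exp_lt0; rewrite e ltxx. Qed.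

Lemma gz_coef : 'i%C / (2 * sqrtC z) = - (2 * decay_exp)^-1.
Proof.
have s0 : sqrtC z != 0 by have := decay_exp_neq0; rewrite /decay_exp mulf_eq0 negb_or => /andP[].
have i0 : ('i%C : C) != 0 by have := decay_exp_neq0; rewrite /decay_exp mulf_eq0 negb_or => /andP[].
have ii : 'i%C * 'i%C = -1 :> C by rewrite -expr2 sqr_i.
apply: (mulfI i0); rewrite mulrA ii /decay_exp mulrN invfM invfM.
by field; rewrite s0 i0.
Qed.

Lemma gzE c x : gz z (x - c) = - (2 * decay_exp)^-1 * wexp decay_exp `|x - c|.
Proof. by rewrite /gz gz_coef. Qed.

Lemma gz_split c x : x != c ->
  gz z (x - c) = - (2 * decay_exp)^-1 * (exp_right decay_exp c x + exp_left decay_exp c x).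
Proof.
move=> xc; rewrite gzE /exp_right /exp_left; congr (_ * _).
have [xltc|cltx|/eqP] := ltgtP x c; last by rewrite (negbTE xc).
- by rewrite add0r distrC gtr0_norm// subr_gt0.
- by rewrite addr0 gtr0_norm// subr_gt0.
Qed.

Lemma dgz_split c x : x != c ->
  cderive (gz z) (x - c) = - 2^-1 * (exp_right decay_exp c x - exp_left decay_exp c x).
Proof.
have w0 := decay_exp_neq0.
have gzy (y : R) : gz z y = - (2 * decay_exp)^-1 * wexp decay_exp `|y|.
  by have := gzE 0 y; rewrite subr0.
move=> xc; rewrite /exp_right /exp_left; apply: is_cderE.
have [xltc|cltx|/eqP] := ltgtP x c; last by rewrite (negbTE xc).
- have h : is_cder (fun y => - (2 * decay_exp)^-1 * wexp decay_exp (0 - y)) (x - c)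
      (- (2 * decay_exp)^-1 * (- decay_exp * wexp decay_exp (0 - (x - c)))).
    by apply: is_cderZ; exact: is_cder_wexp_rev.
  apply: is_cder_eq; first apply: near_is_cder h.
    near=> y; rewrite gzy ler0_norm ?sub0r//.
    by rewrite ltW//; near: y; apply: lt_nbhsl; rewrite subr_lt0.
  by rewrite sub0r opprB; field.
- have h : is_cder (fun y => - (2 * decay_exp)^-1 * wexp decay_exp y) (x - c)
      (- (2 * decay_exp)^-1 * (decay_exp * wexp decay_exp (x - c))).
    by apply: is_cderZ; exact: is_cder_wexp.
  apply: is_cder_eq; first apply: near_is_cder h.
    near=> y; rewrite gzy ger0_norm//.
    by rewrite ltW//; near: y; apply: lt_nbhsr; rewrite subr_gt0.
  by field.
Unshelve. all: end_near. Qed.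

Lemma cmeasurable_gz c : cmeasurable (fun x => gz z (x - c)).
Proof.
have -> : (fun x => gz z (x - c)) = fun x => if x == c then gz z 0 else
    - (2 * decay_exp)^-1 * (exp_right decay_exp c x + exp_left decay_exp c x).
  apply/funext => x; case: eqVneq => [->|xc]; first by rewrite subrr.
  exact: gz_split.
apply: cmeasurable_if; [exact: measurable_fun_eqr|exact: cmeasurable_cst|].
by apply: cmeasurableZ; apply: cmeasurableD; [exact: cmeasurable_exp_right|exact: cmeasurable_exp_left].
Qed.

Lemma cmeasurable_dgz c : cmeasurable (fun x => cderive (gz z) (x - c)).
Proof.
have -> : (fun x => cderive (gz z) (x - c)) = fun x =>
    if x == c then cderive (gz z) 0 else - 2^-1 * (exp_right decay_exp c x - exp_left decay_exp c x).
  apply/funext => x; case: eqVneq => [->|xc]; first by rewrite subrr.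
  exact: dgz_split.
apply: cmeasurable_if; [exact: measurable_fun_eqr|exact: cmeasurable_cst|].
by apply: cmeasurableZ; apply: cmeasurableB; [exact: cmeasurable_exp_right|exact: cmeasurable_exp_left].
Qed.

Lemma ae_gz c : {ae mu, forall x,
  - (2 * decay_exp)^-1 * (exp_right decay_exp c x + exp_left decay_exp c x) = gz z (x - c)}.
Proof. by apply: ae_imply (ae_neq c) => x xc; rewrite gz_split. Qed.

Lemma ae_dgz c : {ae mu, forall x,
  - 2^-1 * (exp_right decay_exp c x - exp_left decay_exp c x) = cderive (gz z) (x - c)}.
Proof. by apply: ae_imply (ae_neq c) => x xc; rewrite dgz_split. Qed.

Lemma L2_gz c : L2 (fun x => gz z (x - c)).
Proof.
apply: L2_ae_eq (cmeasurable_gz c) _ (ae_gz c); apply: L2Z.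
by apply: L2D; [exact: L2_exp_right Re_decay_exp_lt0|exact: L2_exp_left Re_decay_exp_lt0].
Qed.

Lemma L2_dgz c : L2 (fun x => cderive (gz z) (x - c)).
Proof.
apply: L2_ae_eq (cmeasurable_dgz c) _ (ae_dgz c); apply: L2Z.
by apply: L2B; [exact: L2_exp_right Re_decay_exp_lt0|exact: L2_exp_left Re_decay_exp_lt0].
Qed.

Lemma Bset_L2 S1 S2 : Bset z S1 S2 `<=` @L2 R.
Proof. by move=> _ [[c _ <-]|[c _ <-]]; [exact: L2_gz|exact: L2_dgz]. Qed.

Lemma L2_helmholtz a b u : csmooth u -> supp_in a b u -> L2 (helmholtz decay_exp u).
Proof.
move=> su u0; apply: (L2_csupp _ a b); last exact: supp_in_helmholtz.
by apply: csmooth_continuous; exact: csmooth_helmholtz.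
Qed.

(** The fundamental solution property: pairing with [g_z (x - c)] evaluates at
[c]. With [pairing_dgz], it identifies orthogonality to the generators with
the vanishing of values and of slopes. *)
Lemma pairing_gz c a b u : csmooth u -> supp_in a b u ->
  cintegral (fun x => gz z (x - c) * helmholtz decay_exp u x) = - u c.
Proof.
move=> su u0; have d2 := L2_helmholtz _ _ _ su u0; have w0 := decay_exp_neq0.
have p2 := L2_exp_right _ c Re_decay_exp_lt0; have m2 := L2_exp_left _ c Re_decay_exp_lt0.
rewrite -(cintegral_ae_eq
  (fun x => - (2 * decay_exp)^-1 * (exp_right decay_exp c x * helmholtz decay_exp u x + exp_left decay_exp c x * helmholtz decay_exp u x))).
- rewrite cintegralZ; last by apply: cintegrableD; exact: cintegrable_L2M.
  rewrite cintegralD; [|exact: cintegrable_L2M|exact: cintegrable_L2M].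
  rewrite (cintegral_exp_right _ _ _ _ _ su u0) (cintegral_exp_left _ _ _ _ _ su u0).
  by field.
- by apply: cmeasurableZ; apply: cmeasurableD; apply: cmeasurableM; exact: L2_cmeasurable.
- by apply: cmeasurableM; [exact: cmeasurable_gz|exact: L2_cmeasurable].
- by apply: ae_imply (ae_gz c) => x <-; rewrite -mulrDl mulrA.
Qed.

Lemma pairing_dgz c a b u : csmooth u -> supp_in a b u ->
  cintegral (fun x => cderive (gz z) (x - c) * helmholtz decay_exp u x) = cderive u c.
Proof.
move=> su u0; have d2 := L2_helmholtz _ _ _ su u0.
have p2 := L2_exp_right _ c Re_decay_exp_lt0; have m2 := L2_exp_left _ c Re_decay_exp_lt0.
rewrite -(cintegral_ae_eq
  (fun x => - 2^-1 * (exp_right decay_exp c x * helmholtz decay_exp u x + (-1) * (exp_left decay_exp c x * helmholtz decay_exp u x)))).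
- rewrite cintegralZ; last first.
    by apply: cintegrableD; [|apply: cintegrableZ]; exact: cintegrable_L2M.
  rewrite cintegralD; [|exact: cintegrable_L2M|by apply: cintegrableZ; exact: cintegrable_L2M].
  rewrite cintegralZ; last exact: cintegrable_L2M.
  rewrite (cintegral_exp_right _ _ _ _ _ su u0) (cintegral_exp_left _ _ _ _ _ su u0).
  by field.
- apply: cmeasurableZ; apply: cmeasurableD; [|apply: cmeasurableZ]; apply: cmeasurableM; exact: L2_cmeasurable.
- by apply: cmeasurableM; [exact: cmeasurable_dgz|exact: L2_cmeasurable].
- by apply: ae_imply (ae_dgz c) => x <-; rewrite -mulrA mulN1r mulrBl.
Qed.

Lemma Lmin_conj u x : csmooth u ->
  (Lmin u x - z^*%C * u x)^*%C = - helmholtz decay_exp (fun y => (u y)^*%C) x.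
Proof.
move=> su; have [su' du] := csmooth_cderive _ su.
have [_ du'] := csmooth_cderive _ su'.
rewrite /helmholtz decay_exp_sqr.
have -> : cderive (fun y => (u y)^*%C) = fun y => (cderive u y)^*%C.
  by apply/funext => y; apply: is_cderE; exact: is_cder_conj.
rewrite (is_cderE _ _ _ (is_cder_conj _ _ _ (du' x))).
by apply: complex_eq; rewrite /Lmin !ReImE; ring.
Qed.

(** Conjugating the test function removes the conjugates from the inner product,
and turns the orthogonality into the weak form of [f'' = w^2 f] off [G]. *)
Lemma deficiencyP G f : deficiency z G f <->
  L2 f /\ forall u, Cc_infty G u -> cintegral (fun x => f x * helmholtz decay_exp u x) = 0.
Proof.
have E u : Cc_infty G u -> L2 f ->
    L2inner f (fun x => Lmin u x - z^*%C * u x) =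
    - cintegral (fun x => f x * helmholtz decay_exp (fun y => (u y)^*%C) x).
  move=> Gu f2; have [su _ _] := Gu; have [a [b u0]] := Cc_infty_supp _ _ Gu.
  rewrite -mulN1r -cintegralZ.
    congr cintegral; apply/funext => x.
    by rewrite (Lmin_conj _ _ su) mulrN mulN1r.
  apply: cintegrable_L2M => //; apply: (L2_helmholtz a b); first exact: csmooth_conj.
  by move=> x /u0 ->; rewrite conjc0.
split=> -[f2 h]; (split; first exact: f2).
- move=> u Gu; pose v : R -> C := fun y => (u y)^*%C.
  have Gv : Cc_infty G v := Cc_infty_conj _ _ Gu.
  have e1 := h _ (ex_intro2 _ _ _ Gv erefl).
  have e2 := E v Gv f2.
  have e3 := etrans (esym e2) e1.
  have e4 : cintegral (fun x => f x * helmholtz decay_exp (fun y => (v y)^*%C) x) = 0.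
    by apply: oppr_inj; rewrite e3 oppr0.
  suff uv : (fun y => (v y)^*%C) = u by rewrite uv in e4.
  by apply/funext => y; rewrite /v conjcK.
- move=> _ [u Gu <-]; rewrite (E _ Gu f2).
  by rewrite (h _ (Cc_infty_conj _ _ Gu)) oppr0.
Qed.

Lemma gz_deficiency G c : G c -> deficiency z G (fun x => gz z (x - c)).
Proof.
move=> Gc; apply/deficiencyP; split; first exact: L2_gz.
move=> u Gu; have [su _ _] := Gu; have [a [b u0]] := Cc_infty_supp _ _ Gu.
by rewrite (pairing_gz _ _ _ _ su u0) (Cc_infty_zero _ _ _ Gu Gc).1 oppr0.
Qed.

Lemma dgz_deficiency G c : G c -> deficiency z G (fun x => cderive (gz z) (x - c)).
Proof.
move=> Gc; apply/deficiencyP; split; first exact: L2_dgz.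
move=> u Gu; have [su _ _] := Gu; have [a [b u0]] := Cc_infty_supp _ _ Gu.
by rewrite (pairing_dgz _ _ _ _ su u0) (Cc_infty_zero _ _ _ Gu Gc).2.
Qed.

Lemma Bset_deficiency G S1 S2 : S1 `<=` G -> S2 `<=` G ->
  Bset z S1 S2 `<=` deficiency z G.
Proof.
move=> s1 s2 _ [[c Sc <-]|[c Sc <-]].
- exact: gz_deficiency (s1 _ Sc).
- exact: dgz_deficiency (s2 _ Sc).
Qed.

Lemma cspan_pairing (B : set (R -> C)) h : B `<=` @L2 R -> L2 h ->
  (forall b, B b -> cintegral (fun x => b x * h x) = 0) ->
  forall f, cspan B f -> cintegral (fun x => f x * h x) = 0.
Proof.
move=> B2 h2 B0 _ [n [c [b [Bb ->]]]].
elim: n c b Bb => [|n IH] c b Bb.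
  rewrite (_ : (fun x => _) = fun x => 0 * h x); last first.
    by apply/funext => x; rewrite big_ord0.
  have := cintegralZ _ 0 (cintegrable_L2M _ _ h2 h2).
  by rewrite mul0r; congr (cintegral _ = _); apply/funext => x; rewrite !mul0r.
have Bb' i : B (b (lift ord0 i)) by exact: Bb.
have s2 : L2 (fun x => \sum_(i < n) c (lift ord0 i) * b (lift ord0 i) x).
  apply: (cspan_L2 _ B2); exists n, (fun i => c (lift ord0 i)), (fun i => b (lift ord0 i)).
  by split.
have b2 : L2 (b ord0) by exact: B2.
rewrite (_ : (fun x => _) = fun x => c ord0 * (b ord0 x * h x) +
    (\sum_(i < n) c (lift ord0 i) * b (lift ord0 i) x) * h x); last first.
  by apply/funext => x; rewrite big_ord_recl mulrDl mulrA.
rewrite cintegralD; [|by apply: cintegrableZ; exact: cintegrable_L2M|exact: cintegrable_L2M].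
rewrite cintegralZ; last exact: cintegrable_L2M.
by rewrite B0// mulr0 add0r (IH (fun i => c (lift ord0 i)) (fun i => b (lift ord0 i))).
Qed.

(** The function [u'' + z u] pairs to zero with the generators, hence by continuity with the
whole deficiency subspace, in particular with the translates of the Green
function and of its derivative at every point of [G]. *)
Lemma total_uniqueness G S1 S2 a b u :
  total_in (Bset z S1 S2) (deficiency z G) ->
  csmooth u -> supp_in a b u ->
  (forall c, S1 c -> u c = 0) -> (forall c, S2 c -> cderive u c = 0) ->
  forall c, G c -> u c = 0 /\ cderive u c = 0.
Proof.
move=> [_ tot] su u0 u1 u2 c Gc.
have d2 := L2_helmholtz _ _ _ su u0.
have N0 f : deficiency z G f -> cintegral (fun x => f x * helmholtz decay_exp u x) = 0.
  rewrite tot => Tf; apply: (pairing_L2closure _ _ _ _ d2 Tf).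
    by apply: cspan_L2; exact: Bset_L2.
  apply: cspan_pairing => //; first exact: Bset_L2.
  move=> _ [[y Sy <-]|[y Sy <-]].
  - by rewrite (pairing_gz _ _ _ _ su u0) u1// oppr0.
  - by rewrite (pairing_dgz _ _ _ _ su u0) u2.
split.
- have := N0 _ (gz_deficiency _ _ Gc); rewrite (pairing_gz _ _ _ _ su u0).
  by move=> /eqP; rewrite oppr_eq0 => /eqP.
- by have := N0 _ (dgz_deficiency _ _ Gc); rewrite (pairing_dgz _ _ _ _ su u0).
Qed.

End deficiency.

(** * Totality forces density and isolated points *)

Section necessity.
Context {R : realType}.
Local Notation C := R[i].
Local Notation mu := (@lebesgue_measure R).
Implicit Types (f g h u : R -> C) (G : set R).

(** An interval has positive measure, so it is not inside [G]; and a point off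
the closed set [G] has a whole neighbourhood off [G]. *)
Lemma null_closed_gap G (p q : R) : closed G -> mu G = 0%E -> p < q ->
  exists a b : R, [/\ p < a, a < b, b < q & `[a, b] `<=` ~` G].
Proof.
move=> cG nG pq.
have [x [px xq Gx]] : exists x, [/\ p < x, x < q & ~ G x].
  apply: contrapT => h.
  have sub : (`]p, q[%classic : set R) `<=` G.
    move=> x; rewrite /= in_itv /= => /andP[px xq].
    by apply: contrapT => nGx; apply: h; exists x.
  have : (mu `]p, q[%classic <= mu G)%E.
    by apply: le_measure => //; rewrite inE; [exact: measurable_itv|exact: closed_measurable].
  by rewrite nG lebesgue_measure_itv /= lte_fin pq -EFinB lee_fin leNgt subr_gt0 pq.
have : nbhs x (~` G) by apply: open_nbhs_nbhs; split => //; exact: closed_openC.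
move=> /nbhs_ballP[e /= e0 eG].
pose d := Num.min e (Num.min (x - p) (q - x)) / 2.
have d0 : 0 < d by rewrite divr_gt0// !lt_min e0 !subr_gt0 px xq.
have : d + d <= e by rewrite -splitr ge_min lexx.
have : d + d <= x - p by rewrite -splitr !ge_min lexx !orbT.
have : d + d <= q - x by rewrite -splitr !ge_min lexx !orbT.
move=> dq dp de; exists (x - d), (x + d); split; [lra|lra|lra|].
move=> y; rewrite /= in_itv /= => /andP[h1 h2].
by apply: eG; rewrite /ball /= ltr_norml; apply/andP; split; lra.
Qed.

(** Otherwise some point [c] of [G] has a neighbourhood without points of [S1].
As [G] is null, there are intervals off [G] on both sides of [c] in that
neighbourhood. A smooth plateau around [c] that climbs and descends inside
these two intervals vanishes on [S1] and is flat on [G], but is 1 at [c]. *)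
Lemma total_dense (z : C) G S1 S2 : ~~ (0 <= z) ->
  closed G -> mu G = 0%E -> S2 `<=` G ->
  total_in (Bset z S1 S2) (deficiency z G) -> G `<=` closure S1.
Proof.
move=> z0 cG nG s2 tot c Gc; apply: contrapT => nc.
have : nbhs c (~` closure S1).
  by apply: open_nbhs_nbhs; split => //; apply: closed_openC; exact: closed_closure.
move=> /nbhs_ballP[r /= r0 rS].
have cr1 : c - r < c by lra.
have cr2 : c < c + r by lra.
have [a1 [b1 [ra1 ab1 bc1 G1]]] := null_closed_gap _ _ _ cG nG cr1.
have [a2 [b2 [ca2 ab2 br2 G2]]] := null_closed_gap _ _ _ cG nG cr2.
have step a b : a < b -> exists v P : R -> C, [/\ csmooth P,
    supp_in a b v, forall x, is_cder P x (v x),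
    forall x, x < a -> P x = 0 & forall x, b < x -> P x = 1].
  move=> ab; have I0 := cintegral_bump_neq0 _ _ ab.
  have k0 : (0 : R) < 1 by [].
  have [P [sP dP P0 P1]] := csmooth_primitive _ a b (csmooth_bump a b 1) (supp_in_bump a b 1 k0).
  set I := cintegral _ in I0 P1.
  exists (fun x => I^-1 * (bump a b 1 x)%:C%C), (fun x => I^-1 * P x); split.
  - exact: csmoothZ.
  - by move=> x /(supp_in_bump a b 1 k0) ->; rewrite mulr0.
  - by move=> x; exact: is_cderZ.
  - by move=> x /P0 ->; rewrite mulr0.
  - by move=> x /P1 ->; rewrite mulVf.
have [v1 [P1 [sP1 v10 dP1 P10 P11]]] := step _ _ ab1.
have [v2 [P2 [sP2 v20 dP2 P20 P21]]] := step _ _ ab2.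
(* [u] is 1 between the two gaps and 0 beyond them. *)
pose u x := P1 x - P2 x.
have su : csmooth u by exact: csmoothB.
have du x : cderive u x = v1 x - v2 x by apply: is_cderE; exact: is_cderB.
have u0 : supp_in a1 b2 u.
  move=> x /orP[xa|bx]; rewrite /u.
    by rewrite P10// P20 ?subrr//; lra.
  by rewrite P11 ?P21 ?subrr//; lra.
have z1 y : S1 y -> u y = 0.
  move=> Sy; apply: u0; have nry : ~ ball c r y.
    by move=> /rS; apply; exact: subset_closure.
  apply/negPn/negP; rewrite negb_or -!leNgt => /andP[h1 h2]; apply: nry.
  by rewrite /ball /= ltr_norml; apply/andP; split; lra.
have z2 y : S2 y -> cderive u y = 0.
  move=> /s2 Gy; rewrite du v10 ?v20 ?subrr//.
    apply/negPn/negP; rewrite negb_or -!leNgt => h.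
    by have := G2 y; rewrite /= in_itv /= => /(_ h); apply.
  apply/negPn/negP; rewrite negb_or -!leNgt => h.
  by have := G1 y; rewrite /= in_itv /= => /(_ h); apply.
have [+ _] := total_uniqueness _ z0 _ _ _ _ _ _ tot su u0 z1 z2 _ Gc.
rewrite /u P11// P20// subr0 => /eqP; by rewrite oner_eq0.
Qed.

(** Otherwise let [c] be isolated in [G] and not in [S2]. The function [x - c]
times a bump supported near [c] vanishes on [G], and has zero slope at every
point of [G] but [c]. *)
Lemma total_isolated (z : C) G S1 S2 : ~~ (0 <= z) -> S1 `<=` G -> S2 `<=` G ->
  total_in (Bset z S1 S2) (deficiency z G) -> isolated G `<=` S2.
Proof.
move=> z0 s1 s2 tot c [/set_mem Gc [V nV VG]]; apply: contrapT => nc.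
move: nV => /nbhs_ballP[r /= r0 rV].
have only y : G y -> ball c r y -> y = c.
  move=> Gy /rV Vy; have : (V `&` G) y by split.
  by rewrite VG.
pose a := c - r / 2; pose b := c + r / 2.
have k0 : (0 : R) < 1 by [].
have r20 : 0 < r / 2 by rewrite divr_gt0.
pose u x : C := (x%:C%C - c%:C%C) * (bump a b 1 x)%:C%C.
have sb := csmooth_bump a b 1.
have [_ db] := csmooth_cderive _ sb.
have su : csmooth u.
  apply: csmoothM; last exact: sb.
  by apply: csmoothB; [exact: csmooth_id|exact: csmooth_cst].
have u0 : supp_in a b u.
  by move=> x /(supp_in_bump a b 1 k0); rewrite /u => ->; rewrite mulr0.
have out y : G y -> y != c -> (y < a) || (b < y).
  move=> Gy yc; apply/negPn/negP; rewrite negb_or -!leNgt /a /b => /andP[h1 h2].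
  move/eqP: yc; apply; apply: only => //.
  by rewrite /ball /= ltr_norml; apply/andP; split; lra.
have z1 y : S1 y -> u y = 0.
  move=> /s1 Gy; have [->|yc] := eqVneq y c; first by rewrite /u subrr mul0r.
  by apply: u0; exact: out.
have z2 y : S2 y -> cderive u y = 0.
  move=> Sy; apply: (supp_in_cderive a b _ u0); apply: out; first exact: s2.
  by apply/eqP => yc; apply: nc; rewrite -yc.
have [_] := total_uniqueness _ z0 _ _ _ _ _ _ tot su u0 z1 z2 _ Gc.
have -> : cderive u c = (bump a b 1 c)%:C%C.
  apply: is_cderE; apply: is_cder_eq.
    apply: is_cderM; last exact: db.
    apply: is_cderB; last exact: is_cder_cst.
    by apply: is_cder_real; exact: is_derive_id.
  by rewrite /= subrr mul0r addr0 subr0 mul1r.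
move=> [] /eqP; rewrite gt_eqF// bump_gt0// /a /b.
by apply/andP; split; lra.
Qed.

End necessity.

(** * Weak solutions, dual form *)

Section weak_solutions.
Context {R : realType}.
Local Notation C := R[i].
Local Notation mu := (@lebesgue_measure R).
Implicit Types (f g h u : R -> C) (I : set R).

Definition test_on I u := csmooth u /\ exists c d, `[c, d] `<=` I /\ supp_in c d u.

Lemma test_onD I u v : is_interval I -> test_on I u -> test_on I v ->
  test_on I (fun x => u x + v x).
Proof.
move=> iI [su [a [b [abI u0]]]] [sv [c [d [cdI v0]]]]; split; first exact: csmoothD.
have [ab|ba] := leP a b; last first.
  exists c, d; split => // x h; rewrite v0// u0 ?addr0//.
  by case: (ltP x a) => //= ax; exact: lt_le_trans ba ax.
have [cd|dc] := leP c d; last first.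
  exists a, b; split => // x h; rewrite u0// v0 ?addr0//.
  by case: (ltP x c) => //= ax; exact: lt_le_trans dc ax.
have Ia : I a by apply: abI; rewrite /= in_itv /= lexx ab.
have Ib : I b by apply: abI; rewrite /= in_itv /= lexx ab.
have Ic : I c by apply: cdI; rewrite /= in_itv /= lexx cd.
have Id : I d by apply: cdI; rewrite /= in_itv /= lexx cd.
exists (Num.min a c), (Num.max b d); split.
  move=> x; rewrite /= in_itv /= => /andP[h1 h2].
  apply: (iI (Num.min a c) (Num.max b d)); last by rewrite h1 h2.
  - by case: (leP a c).
  - by case: (leP b d).
move=> x; rewrite lt_min gt_max => /orP[/andP[h1 h2]|/andP[h1 h2]].
  by rewrite u0 ?v0 ?addr0 ?h1 ?h2.
by rewrite u0 ?v0 ?addr0 ?h1 ?h2 ?orbT.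
Qed.

Lemma test_onM I u v : csmooth v -> test_on I u -> test_on I (fun x => v x * u x).
Proof.
move=> sv [su [a [b [abI u0]]]]; split; first exact: csmoothM.
by exists a, b; split => // x /u0 ->; rewrite mulr0.
Qed.

Lemma test_onZ I u (c : C) : test_on I u -> test_on I (fun x => c * u x).
Proof. by apply: test_onM; exact: csmooth_cst. Qed.

Lemma test_on_cderive I u : test_on I u -> test_on I (cderive u).
Proof.
move=> [su [a [b [abI u0]]]]; split; first by have [] := csmooth_cderive _ su.
by exists a, b; split => //; exact: supp_in_cderive.
Qed.

Lemma cintegrable_test I u : test_on I u -> cintegrable u.
Proof.
move=> [su [a [b [_ u0]]]]; have [c1 c2] := csmooth_continuous _ su; split.
- by apply: (integrable_csupp _ a b) => // x /u0; rewrite /reF => ->.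
- by apply: (integrable_csupp _ a b) => // x /u0; rewrite /imF => ->.
Qed.

Lemma L2_test I u : test_on I u -> L2 u.
Proof.
move=> [su [a [b [_ u0]]]]; apply: L2_csupp u0.
exact: csmooth_continuous.
Qed.

Lemma cintegral_cderive_test I u : test_on I u -> cintegral (cderive u) = 0.
Proof.
move=> [su [a [b [_ u0]]]]; have [su' du] := csmooth_cderive _ su.
pose p := Num.min a b - 1; pose q := Num.max a b + 1.
have pa : p < a by rewrite ltrBlDr ltr_pwDr// ge_min lexx.
have bq : b < q by rewrite ltr_pwDr// le_max lexx orbT.
have pq : p < q.
  have h : Num.min a b <= Num.max a b by rewrite ge_min le_max lexx.
  by rewrite /p /q; lra.
rewrite (cintegral_FTC u (cderive u) _ p q pq) ?u0 ?pa ?bq ?orbT ?subrr//.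
- exact: csmooth_continuous.
- exact: cmeasurable_csmooth.
- move=> x h; apply: (supp_in_cderive a b _ u0).
  case/orP: h => h; first by rewrite (lt_trans h pa).
  by rewrite (lt_trans bq h) orbT.
Qed.

(** A functional that vanishes on the range of [D + w] is a multiple of the
pairing with [e^(w x)], because a test function orthogonal to [e^(w x)] is in
that range: [e^(- w x)] times the primitive of [e^(w x) u] again has compact
support. *)
Lemma first_order_dual I (c0 d0 : R) (w : C) (l : (R -> C) -> C) :
  is_interval I -> c0 < d0 -> `[c0, d0] `<=` I ->
  (forall u v (a : C), test_on I u -> test_on I v ->
     l (fun x => u x + a * v x) = l u + a * l v) ->
  (forall u, test_on I u -> l (fun x => cderive u x + w * u x) = 0) ->
  exists k, forall u, test_on I u -> l u = k * cintegral (fun x => wexp w x * u x).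
Proof.
move=> iI cd0 cdI lin lD.
have I0 := cintegral_bump_neq0 _ _ cd0; set J := cintegral _ in I0.
pose phi x := J^-1 * (wexp (- w) x * (bump c0 d0 1 x)%:C%C).
have k0 : (0 : R) < 1 by [].
have tb : test_on I (fun x => (bump c0 d0 1 x)%:C%C).
  by split; [exact: csmooth_bump|exists c0, d0; split => //; exact: supp_in_bump].
have tphi : test_on I phi.
  by apply: test_onZ; apply: test_onM => //; exact: csmooth_wexp.
have phi1 : cintegral (fun x => wexp w x * phi x) = 1.
  have -> : (fun x => wexp w x * phi x) = fun x => J^-1 * (bump c0 d0 1 x)%:C%C.
    by apply/funext => x; rewrite /phi mulrCA [wexp w x * _]mulrA wexpNK mul1r.
  by rewrite cintegralZ ?mulVf//; exact: cintegrable_test tb.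
exists (l phi) => u tu.
pose m := cintegral (fun x => wexp w x * u x).
(* The component of [u] orthogonal to [e^(w x)]. *)
pose chi x := u x + (- m) * phi x.
have tchi : test_on I chi by apply: test_onD => //; exact: test_onZ.
have swchi : test_on I (fun x => wexp w x * chi x) by apply: test_onM => //; exact: csmooth_wexp.
have chi0 : cintegral (fun x => wexp w x * chi x) = 0.
  have -> : (fun x => wexp w x * chi x) =
      fun x => wexp w x * u x + (- m) * (wexp w x * phi x).
    by apply/funext => x; rewrite /chi mulrDr mulrCA.
  have i1 : cintegrable (fun x => wexp w x * u x).
    by apply: (cintegrable_test I); apply: test_onM => //; exact: csmooth_wexp.
  have i2 : cintegrable (fun x => wexp w x * phi x).
    by apply: (cintegrable_test I); apply: test_onM => //; exact: csmooth_wexp.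
  rewrite cintegralD//; last exact: cintegrableZ.
  by rewrite cintegralZ// phi1 mulr1 subrr.
have [sw [c [d [cdI' w0]]]] := swchi.
have [P [sP dP P0 P1]] := csmooth_primitive _ c d sw w0.
pose psi x := wexp (- w) x * P x.
have tP : test_on I P.
  split => //; exists c, d; split => // x /orP[/P0//|/P1].
  by rewrite chi0.
have tpsi : test_on I psi by exact: (test_onM _ _ _ (csmooth_wexp (- w)) tP).
have := lD _ tpsi.
have -> : (fun x => cderive psi x + w * psi x) = chi.
  apply/funext => x.
  have -> : cderive psi x = - w * wexp (- w) x * P x + wexp (- w) x * (wexp w x * chi x).
    by apply: is_cderE; apply: is_cderM; [exact: is_cder_wexp|exact: dP].
  rewrite [wexp (- w) x * (_ * _)]mulrA [wexp (- w) x * wexp w x]mulrC wexpNK mul1r /psi.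
  ring.
rewrite /chi lin// => /eqP; rewrite mulNr subr_eq0 => /eqP ->.
by rewrite mulrC.
Qed.

(** The operator factors as [(D - w) (D + w)], and [first_order_dual] is applied
to one factor after the other: first to the functional
[u |-> int f (u' - w u)], then, after subtraction of a multiple of [e^(w x)],
to [u |-> int f u] with [- w] in place of [w]. *)
Lemma weak_solution_dual I (c0 d0 : R) (w : C) f : w != 0 ->
  is_interval I -> c0 < d0 -> `[c0, d0] `<=` I -> L2 f ->
  (forall u, test_on I u -> cintegral (fun x => f x * helmholtz w u x) = 0) ->
  exists A B : C, forall u, test_on I u ->
    cintegral (fun x => (f x - (A * wexp w x + B * wexp (- w) x)) * u x) = 0.
Proof.
move=> w0 iI cd0 cdI f2 fw.
have if2 u : test_on I u -> cintegrable (fun x => f x * u x).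
  by move=> tu; apply: cintegrable_L2M => //; exact: L2_test tu.
have iex v u : test_on I u -> cintegrable (fun x => wexp v x * u x).
  by move=> tu; apply: (cintegrable_test I); apply: test_onM => //; exact: csmooth_wexp.
have tD (v : C) u : test_on I u -> test_on I (fun x => cderive u x + v * u x).
  by move=> tu; apply: test_onD => //; [exact: test_on_cderive|exact: test_onZ].
pose l0 u := cintegral (fun x => f x * u x).
have l0lin u v (a : C) : test_on I u -> test_on I v ->
    l0 (fun x => u x + a * v x) = l0 u + a * l0 v.
  move=> tu tv; rewrite /l0 -cintegralZ; last exact: if2.
  rewrite -cintegralD; [|exact: if2|by apply: cintegrableZ; exact: if2].
  by congr cintegral; apply/funext => x; ring.
pose l1 u := l0 (fun x => cderive u x + (- w) * u x).
have cderZ u v (a : C) x : csmooth u -> csmooth v ->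
    cderive (fun x => u x + a * v x) x = cderive u x + a * cderive v x.
  move=> /csmooth_cderive[_ du] /csmooth_cderive[_ dv].
  by apply: is_cderE; apply: is_cderD => //; exact: is_cderZ.
have l1lin u v (a : C) : test_on I u -> test_on I v ->
    l1 (fun x => u x + a * v x) = l1 u + a * l1 v.
  move=> tu tv; rewrite /l1 -l0lin; [|exact: tD|exact: tD].
  congr l0; apply/funext => x.
  by rewrite cderZ; [ring|exact: tu.1|exact: tv.1].
have l1D u : test_on I u -> l1 (fun x => cderive u x + w * u x) = 0.
  move=> tu; rewrite -(fw u tu) /l1 /l0; congr cintegral; apply/funext => x.
  have [su' _] := csmooth_cderive _ tu.1.
  rewrite (cderZ _ _ _ _ su' tu.1) /helmholtz; congr (_ * _); ring.
have [k hk] := first_order_dual _ _ _ _ _ iI cd0 cdI l1lin l1D.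
(* Integrating by parts, [int e^(w x) (u' - w u) = - 2 w int e^(w x) u]; the
   coefficient makes [l2] vanish on the range of [D - w]. *)
pose l2 u := l0 u + k / (2 * w) * cintegral (fun x => wexp w x * u x).
have exlin s u v (a : C) : test_on I u -> test_on I v ->
    cintegral (fun x => wexp s x * (u x + a * v x)) =
    cintegral (fun x => wexp s x * u x) + a * cintegral (fun x => wexp s x * v x).
  move=> tu tv; rewrite -cintegralZ; last exact: iex.
  rewrite -cintegralD; [|exact: iex|by apply: cintegrableZ; exact: iex].
  by congr cintegral; apply/funext => x; ring.
have l2lin u v (a : C) : test_on I u -> test_on I v ->
    l2 (fun x => u x + a * v x) = l2 u + a * l2 v.
  by move=> tu tv; rewrite /l2 l0lin// exlin//; ring.
have l2D u : test_on I u -> l2 (fun x => cderive u x + (- w) * u x) = 0.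
  move=> tu; rewrite /l2 -/(l1 u) (hk u tu).
  have -> : cintegral (fun x => wexp w x * (cderive u x + (- w) * u x)) =
      - (2 * w) * cintegral (fun x => wexp w x * u x).
    have tw : test_on I (fun x => wexp w x * u x) by apply: test_onM => //; exact: csmooth_wexp.
    have := cintegral_cderive_test _ _ tw.
    have -> : cderive (fun x => wexp w x * u x) = fun x =>
       wexp w x * (cderive u x + (- w) * u x) + (2 * w) * (wexp w x * u x).
      apply/funext => x; apply: is_cderE; apply: is_cder_eq.
        apply: is_cderM; first exact: is_cder_wexp.
        by have [_ ] := csmooth_cderive _ tu.1; apply.
      ring.
    rewrite cintegralD; [|by apply: iex; exact: tD|by apply: cintegrableZ; exact: iex].
    rewrite cintegralZ; last exact: iex.
    by move=> /eqP; rewrite addr_eq0 => /eqP ->; rewrite mulNr.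
  by field.
have [k' hk'] := first_order_dual _ _ _ _ _ iI cd0 cdI l2lin l2D.
exists (- (k / (2 * w))), k' => u tu.
have -> : (fun x => (f x - (- (k / (2 * w)) * wexp w x + k' * wexp (- w) x)) * u x) =
   fun x => (f x * u x + k / (2 * w) * (wexp w x * u x)) + (- k') * (wexp (- w) x * u x).
  by apply/funext => x; ring.
have i1 := if2 _ tu; have i2 := iex w _ tu; have i3 := iex (- w) _ tu.
rewrite cintegralD; [|by apply: cintegrableD => //; exact: cintegrableZ|exact: cintegrableZ].
rewrite cintegralD//; last exact: cintegrableZ.
rewrite !cintegralZ//.
have := hk' _ tu; rewrite /l2 /l0 => ->; ring.
Qed.

End weak_solutions.

(** * Weak solutions, pointwise form *)

Section fundamental_lemma.
Context {R : realType}.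
Local Notation C := R[i].
Local Notation mu := (@lebesgue_measure R).
Implicit Types (f g h u : R -> C) (I : set R).

Lemma measurable_bump (c d k : R) : measurable_fun setT (bump c d k).
Proof.
have [+ _] := cmeasurable_csmooth _ (csmooth_bump c d k).
by rewrite (_ : reF _ = bump c d k).
Qed.

Lemma integrable_patch_itv (k : R -> R) (c d : R) :
  mu.-integrable `[c, d] (EFin \o k) -> mu.-integrable setT (EFin \o (k \_ `[c, d])).
Proof.
move=> ik; rewrite -restrict_EFin.
by have [h _] := @integrable_mkcond _ _ _ mu `[c, d]%classic (EFin \o k) (measurable_itv _); exact: h.
Qed.

Lemma integrable_le_itv (f g : R -> R) (c d : R) : measurable_fun setT f ->
  (forall x, `|f x| <= g x) -> mu.-integrable `[c, d] (EFin \o g) ->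
  mu.-integrable `[c, d] (EFin \o f).
Proof.
move=> mf fg; apply: le_integrable => //.
  by apply/measurable_EFinP; exact: measurable_funTS.
by move=> x _ /=; rewrite lee_fin (le_trans (fg x))// ler_norm.
Qed.

(** Dominated convergence, the bumps tending to the indicator of the interval. *)
Lemma integral_itv_eq0 (k : R -> R) (c d : R) : c < d ->
  measurable_fun setT k -> mu.-integrable `[c, d] (EFin \o k) ->
  (forall n, (\int[mu]_x (k x * bump c d n.+1%:R x))%R = 0) ->
  (\int[mu]_(x in `[c, d]) k x)%R = 0.
Proof.
move=> cd mk ik k0.
have idom : mu.-integrable setT (EFin \o (fun x => `|(k \_ `[c, d]) x|)).
  exact: integrable_norm (integrable_patch_itv _ _ _ ik).
have mf n : measurable_fun setT (fun x => k x * bump c d n.+1%:R x).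
  by apply: measurable_funM => //; exact: measurable_bump.
have dom n x : `|k x * bump c d n.+1%:R x| <= `|(k \_ `[c, d]) x|.
  rewrite patchE; case: ifPn => [_|].
    by rewrite normrM ler_piMr// ger0_norm ?bump_ge0 ?bump_le1.
  rewrite notin_setE /= in_itv /= => /negP h; rewrite bump_out ?mulr0//.
  by apply: contra h => /andP[/ltW -> /ltW ->].
have i_n n : mu.-integrable setT (EFin \o (fun x => k x * bump c d n.+1%:R x)).
  by apply: integrable_leR idom => //; exact: dom.
have [|||||_ _] := @dominated_convergence _ _ R mu setT measurableT
   (fun n => EFin \o (fun x => k x * bump c d n.+1%:R x))
   (EFin \o (k \_ `[c, d])) (EFin \o (fun x => `|(k \_ `[c, d]) x|)) _ _ _ _ _.
- by move=> n; apply/measurable_EFinP; exact: mf.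
- rewrite -restrict_EFin; apply/(measurable_restrictT _ _).1 => //.
  by apply/measurable_EFinP; exact: measurable_funTS.
- apply: ae_imply (ae_and _ _ (ae_neq c) (ae_neq d)) => x [xc xd] _.
  apply: cvg_EFin; first exact: nearW.
  rewrite /= patchE; case: ifPn.
    rewrite inE /= in_itv /= => /andP[cx dx].
    rewrite -[X in _ --> X]mulr1; apply: cvgM; first exact: cvg_cst.
    by apply: cvg_bump; rewrite !lt_neqAle cx dx eq_sym xc xd.
  rewrite notin_setE /= in_itv /= => /negP h.
  rewrite (_ : (fun _ => _) = fun=> 0); first exact: cvg_cst.
  apply/funext => n /=; rewrite bump_out ?mulr0//.
  by apply: contra h => /andP[/ltW -> /ltW ->].
- exact: idom.
- by apply: aeW => x n _ /=; rewrite lee_fin; exact: dom.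
move=> lim0.
have E n : (\int[mu]_x (k x * bump c d n.+1%:R x)%R%:E = 0)%E.
  have := k0 n; rewrite /Rintegral => h.
  have fn := integrable_fin_num measurableT (i_n n).
  by rewrite -[LHS](fineK fn); exact: (congr1 EFin h).
rewrite Rintegral_mkcond /Rintegral.
suff -> : (\int[mu]_x ((k \_ `[c, d]) x)%:E = 0)%E by [].
apply: cvg_unique lim0 _ => //.
rewrite (_ : (fun n => _) = fun=> 0%E); first exact: cvg_cst.
by apply/funext => n; exact: E.
Qed.

(** All the integrals of [k] over subintervals vanish, so the indefinite integral
of [k] is constant; by Lebesgue differentiation its derivative is [k] almost
everywhere. *)
Lemma ae_eq0_itv (k : R -> R) (c0 d0 : R) : c0 < d0 ->
  measurable_fun setT k -> mu.-integrable `[c0, d0] (EFin \o k) ->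
  (forall c d, c0 <= c -> d <= d0 -> c < d ->
     forall n, (\int[mu]_x (k x * bump c d n.+1%:R x))%R = 0) ->
  {ae mu, forall x, c0 <= x <= d0 -> k x = 0}.
Proof.
move=> cd0 mk ik k0.
pose K := k \_ `[c0, d0].
have iK : mu.-integrable setT (EFin \o K).
  exact: integrable_patch_itv.
have sub c d : c0 <= c -> d <= d0 -> c < d -> (\int[mu]_(x in `[c, d]) k x)%R = 0.
  move=> h1 h2 cd; apply: integral_itv_eq0 => //; last exact: k0.
  apply: integrableS ik => //.
  by move=> x; rewrite /= !in_itv /= => /andP[h3 h4]; rewrite (le_trans h1 h3) (le_trans h4 h2).
have F0 x : (\int[mu]_(t in `]-oo, x]) K t)%R = 0.
  rewrite -Rintegral_mkcondr.
  have [xc|cx|->] := ltgtP x c0.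
  - rewrite (_ : _ `&` _ = set0) ?Rintegral_set0//.
    apply/seteqP; split => // t [] /=; rewrite !in_itv /= => tx /andP[ct _].
    by have := le_lt_trans (le_trans ct tx) xc; rewrite ltxx.
  - rewrite (_ : _ `&` _ = `[c0, Num.min x d0]%classic).
      by apply: sub; rewrite // ?ge_min ?lexx ?orbT// lt_min cx cd0.
    apply/seteqP; split => t /=; rewrite !in_itv /= le_min.
      by move=> [-> /andP[-> ->]].
    by move=> /and3P[-> -> ->].
  - rewrite (_ : _ `&` _ = [set c0]) ?Rintegral_set1//.
    apply/seteqP; split => t /=; rewrite !in_itv /=.
      by move=> [tc /andP[ct _]]; apply/eqP; rewrite eq_le tc ct.
    by move=> ->; rewrite lexx (ltW cd0).
have lK : locally_integrable setT K.
  exact: integrable_locally_restrict (measurable_itv _) ik.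
have iKy y : mu.-integrable `]-oo, y] (EFin \o K) by apply: integrableS iK.
have := FTC1Ny iKy lK.
apply: ae_imply => x [_ + xcd].
rewrite (_ : (fun _ => _) = fun=> 0); last by apply/funext => y; exact: F0.
rewrite derive1_cst /K patchE ifT; first by move=> <-.
by rewrite inE /= in_itv.
Qed.

(** An open set is the union of the countably many intervals with rational end
points that it contains. *)
Lemma ae_eq0_open (k : R -> R) I : open I -> measurable_fun setT k ->
  (forall c d, c < d -> `[c, d] `<=` I -> mu.-integrable `[c, d] (EFin \o k)) ->
  (forall c d, c < d -> `[c, d] `<=` I ->
     forall n, (\int[mu]_x (k x * bump c d n.+1%:R x))%R = 0) ->
  {ae mu, forall x, I x -> k x = 0}.
Proof.
move=> oI mk ik k0.
pose P n (x : R) := forall p q : rat, unpickle n = Some (p, q) ->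
  ratr p < ratr q :> R -> `[ratr p, ratr q] `<=` I -> ratr p <= x <= ratr q -> k x = 0.
have aeP n : {ae mu, forall x, P n x}.
  case E : (unpickle n : option (rat * rat)) => [[p q]|]; last first.
    by apply: aeW => x p q; rewrite E.
  have [pq|qp] := ltP (ratr p : R) (ratr q); last first.
    apply: aeW => x p' q'; rewrite E => -[<- <-].
    by rewrite ltNge qp.
  have [pqI|npqI] := pselect (`[ratr p, ratr q] `<=` I); last first.
    by apply: aeW => x p' q'; rewrite E => -[<- <-].
  have : {ae mu, forall x, ratr p <= x <= ratr q -> k x = 0}.
    apply: ae_eq0_itv => //; first exact: ik.
    move=> c d h1 h2 cd; apply: k0 => //; apply: subset_trans pqI.
    by move=> x; rewrite /= !in_itv /= => /andP[h3 h4]; rewrite (le_trans h1 h3) (le_trans h4 h2).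
  by apply: ae_imply => x h p' q'; rewrite E => -[<- <-] _ _; exact: h.
have := ae_foralln aeP.
apply: ae_imply => x Px Ix.
have : nbhs x I by apply: open_nbhs_nbhs.
move=> /nbhs_ballP[e /= e0 eI].
have [p] : exists p : rat, ratr p \in `]x - e, x[.
  by apply: rat_in_itvoo; rewrite ltrBlDr ltrDl.
rewrite in_itv /= => /andP[p1 p2].
have [q] : exists q : rat, ratr q \in `]x, x + e[.
  by apply: rat_in_itvoo; rewrite ltrDl.
rewrite in_itv /= => /andP[q1 q2].
apply: (Px (pickle (p, q)) p q); [exact: pickleK|exact: lt_trans q1| |].
- move=> y; rewrite /= in_itv /= => /andP[y1 y2]; apply: eI.
  by rewrite /ball /= ltr_norml; apply/andP; split; lra.
- by rewrite (ltW p2) (ltW q1).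
Qed.

Lemma integrable_itv_reF f (c d : R) : L2 f ->
  mu.-integrable `[c, d] (EFin \o reF f) /\ mu.-integrable `[c, d] (EFin \o imF f).
Proof.
move=> f2; have [m1 m2] := L2_cmeasurable _ f2.
have ci : mu.-integrable `[c, d] (EFin \o (fun=> 1 : R)).
  apply: continuous_compact_integrable; first exact: segment_compact.
  by apply: continuous_subspaceT => x; exact: cvg_cst.
have si : mu.-integrable `[c, d] (EFin \o (fun x => normsq (f x))).
  by apply: integrableS (integrable_normsq _ f2).
have i1 : mu.-integrable `[c, d] (EFin \o (fun x => 1 + normsq (f x))).
  by have h := @integrableD _ _ _ mu `[c, d]%classic (measurable_itv _) _ _ ci si; exact: h.
have key (a b : R) : `|a| <= 1 + (a ^+ 2 + b ^+ 2).
  have : 0 <= (`|a| - 1) ^+ 2 by exact: sqr_ge0.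
  have := sqr_ge0 b; have := real_normK (num_real a); nra.
split; apply: integrable_le_itv i1 => // x; first exact: key.
by rewrite /normsq [Re _ ^+ 2 + _]addrC; exact: key.
Qed.

Lemma integrable_itv_continuous (k : R -> R) (c d : R) : continuous k ->
  mu.-integrable `[c, d] (EFin \o k).
Proof.
move=> ck; apply: continuous_compact_integrable; first exact: segment_compact.
exact: continuous_subspaceT.
Qed.

(** Weak solutions of [u'' = w^2 u] are classical ones: [weak_solution_dual]
provides the exponentials, and the difference with [f] is orthogonal to all
bumps inside [I]. *)
Lemma weak_solution_exp I (x0 : R) (w : C) f : w != 0 ->
  open I -> is_interval I -> I x0 -> L2 f ->
  (forall u, test_on I u -> cintegral (fun x => f x * helmholtz w u x) = 0) ->
  exists A B : C, {ae mu, forall x, I x -> f x = A * wexp w x + B * wexp (- w) x}.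
Proof.
move=> w0 oI iI Ix0 f2 fw.
have : nbhs x0 I by apply: open_nbhs_nbhs.
move=> /nbhs_ballP[e /= e0 eI].
have cd0 : x0 - e / 2 < x0 + e / 2 by have : 0 < e / 2 by [rewrite divr_gt0]; lra.
have cdI : `[x0 - e / 2, x0 + e / 2] `<=` I.
  move=> y; rewrite /= in_itv /= => /andP[y1 y2]; apply: eI.
  by rewrite /ball /= ltr_norml; apply/andP; split; lra.
have [A [B AB]] := weak_solution_dual _ _ _ _ _ w0 iI cd0 cdI f2 fw.
exists A, B.
pose s x := A * wexp w x + B * wexp (- w) x.
have ss : csmooth s by apply: csmoothD; apply: csmoothZ; exact: csmooth_wexp.
have [cs1 cs2] := csmooth_continuous _ ss.
pose g x := f x - s x.
have [mg1 mg2] : cmeasurable g.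
  by apply: cmeasurableB; [exact: L2_cmeasurable|exact: cmeasurable_csmooth].
have ig c d : mu.-integrable `[c, d] (EFin \o reF g) /\ mu.-integrable `[c, d] (EFin \o imF g).
  have [i1 i2] := integrable_itv_reF f c d f2.
  have j1 := integrable_itv_continuous _ c d cs1.
  have j2 := integrable_itv_continuous _ c d cs2.
  split.
  - rewrite (_ : _ \o _ = (EFin \o reF f) \- (EFin \o reF s))%E; first exact: integrableB.
    by apply/funext => x; rewrite /reF /g /= ReD ReN.
  - rewrite (_ : _ \o _ = (EFin \o imF f) \- (EFin \o imF s))%E; first exact: integrableB.
    by apply/funext => x; rewrite /imF /g /= ImD ImN.
have g0 c d : c < d -> `[c, d] `<=` I -> forall n,
    (\int[mu]_x (reF g x * bump c d n.+1%:R x))%R = 0 /\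
    (\int[mu]_x (imF g x * bump c d n.+1%:R x))%R = 0.
  move=> cd cdI' n.
  have tb : test_on I (fun x => (bump c d n.+1%:R x)%:C%C).
    by split; [exact: csmooth_bump|exists c, d; split => //; exact: supp_in_bump].
  have := AB _ tb; rewrite -/(s _) => /eqP; rewrite eq_complex => /andP[/eqP h1 /eqP h2].
  split.
  - rewrite -[RHS]h1 /=; apply: eq_Rintegral => x _.
    by rewrite /reF ReM /= mulr0 subr0.
  - rewrite -[RHS]h2 /=; apply: eq_Rintegral => x _.
    by rewrite /imF ImM /= mulr0 add0r.
have r0 : {ae mu, forall x, I x -> reF g x = 0}.
  apply: ae_eq0_open => //; first by move=> c d _ _; exact: (ig c d).1.
  by move=> c d cd cdI' n; exact: (g0 c d cd cdI' n).1.
have i0 : {ae mu, forall x, I x -> imF g x = 0}.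
  apply: ae_eq0_open => //; first by move=> c d _ _; exact: (ig c d).2.
  by move=> c d cd cdI' n; exact: (g0 c d cd cdI' n).2.
apply: ae_imply (ae_and _ _ r0 i0) => x [h1 h2] Ix; apply/eqP; rewrite -subr_eq0; apply/eqP.
by apply: complex_eq; [exact: h1|exact: h2].
Qed.

End fundamental_lemma.

(** * Estimates for exponentials *)

Section exponential_estimates.
Context {R : realType}.
Local Notation C := R[i].
Local Notation mu := (@lebesgue_measure R).
Implicit Types (f g h : R -> C) (w : C).

Lemma sqr_Re_le (y : C) : Re y ^+ 2 <= normsq y.
Proof. by rewrite lerDl sqr_ge0. Qed.

Lemma sqr_Im_le (y : C) : Im y ^+ 2 <= normsq y.
Proof. by rewrite lerDr sqr_ge0. Qed.

(** Mean value theorem for the real and for the imaginary part; the factor 2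
arises because the two intermediate points differ. *)
Lemma normsq_wexp_sub1 w (t : R) : Re w <= 0 -> 0 <= t ->
  normsq (wexp w t - 1) <= 2 * normsq w * t ^+ 2.
Proof.
move=> w0; rewrite le_eqVlt => /predU1P[<-|t0].
  by rewrite wexp0 subrr normsq0 expr0n mulr0.
have [c1 c2] := csmooth_continuous _ (csmooth_wexp w).
have bd s : 0 < s -> normsq (w * wexp w s) <= normsq w.
  move=> s0; rewrite normsqM normsq_wexp ler_piMr ?normsq_ge0// expR_le1.
  by rewrite pmulr_rle0// mulr_le0_ge0// ltW.
have [|a /[!in_itv]/= /andP[a0 _] ea] := @MVT R (reF (wexp w)) (fun s => Re (w * wexp w s)) 0 t t0
    (fun s _ => (is_cder_wexp w s).1).
  exact: continuous_subspaceT.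
have [|b /[!in_itv]/= /andP[b0 _] eb] := @MVT R (imF (wexp w)) (fun s => Im (w * wexp w s)) 0 t t0
    (fun s _ => (is_cder_wexp w s).2).
  exact: continuous_subspaceT.
have {1}-> : normsq (wexp w t - 1) =
    (Re (w * wexp w a) * t) ^+ 2 + (Im (w * wexp w b) * t) ^+ 2.
  rewrite subr0 in ea eb; rewrite -ea -eb /normsq /reF /imF wexp0 ReD ImD ReN ImN.
  by [].
have ra := le_trans (sqr_Re_le _) (bd _ a0).
have ib := le_trans (sqr_Im_le _) (bd _ b0).
rewrite !exprMn -mulrDl ler_wpM2r ?sqr_ge0//.
by rewrite mulr_natl mulr2n lerD.
Qed.

Lemma normsq_wexp_sub w (s t : R) : Re w <= 0 -> 0 <= s -> 0 <= t ->
  normsq (wexp w s - wexp w t) <=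
    2 * normsq w * (s - t) ^+ 2 * expR (2 * (Re w * Num.min s t)).
Proof.
move=> w0.
have key a b : 0 <= a -> a <= b -> normsq (wexp w a - wexp w b) <=
    2 * normsq w * (a - b) ^+ 2 * expR (2 * (Re w * a)).
  move=> a0 ab.
  have -> : wexp w a - wexp w b = - wexp w a * (wexp w (b - a) - 1).
    have -> : wexp w b = wexp w a * wexp w (b - a) by rewrite -wexpD [a + _]addrC subrK.
    ring.
  rewrite normsqM normsqN normsq_wexp mulrC ler_wpM2r ?expR_ge0//.
  have -> : (a - b) ^+ 2 = (b - a) ^+ 2 by ring.
  by apply: normsq_wexp_sub1; rewrite // subr_ge0.
move=> s0 t0; have [st|ts] := leP s t; first exact: key.
rewrite -normsqN opprB; have -> : (s - t) ^+ 2 = (t - s) ^+ 2 by ring.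
by apply: key => //; exact: ltW.
Qed.

Definition translate_const w (c : R) : R := 2 * normsq w * expR (- 2 * (Re w * (`|c| + 1))).

(** The estimate keeps the decay in [x], so that it can be integrated: it gives
both the continuity of translations and a dominating function for difference
quotients. *)
Lemma normsq_wexp_abs_translate w (c c' x : R) : Re w < 0 -> `|c' - c| <= 1 ->
  normsq (wexp w `|x - c'| - wexp w `|x - c|) <=
    translate_const w c * (c' - c) ^+ 2 * expR (- (- 2 * Re w) * `|x|).
Proof.
move=> w0 cc1; apply: le_trans (normsq_wexp_sub _ _ _ (ltW w0) (normr_ge0 _) (normr_ge0 _)) _.
have -> : translate_const w c * (c' - c) ^+ 2 * expR (- (- 2 * Re w) * `|x|) =
  2 * normsq w * (c' - c) ^+ 2 *
   (expR (- 2 * (Re w * (`|c| + 1))) * expR (- (- 2 * Re w) * `|x|)).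
  by rewrite /translate_const; ring.
apply: ler_pM.
- by apply: mulr_ge0; [apply: mulr_ge0; rewrite ?ler0n ?normsq_ge0|exact: sqr_ge0].
- exact: expR_ge0.
- rewrite ler_wpM2l ?mulr_ge0 ?normsq_ge0//.
  rewrite -(real_normK (num_real (_ - _))) -[leRHS](real_normK (num_real _)).
  rewrite lerXn2r ?nnegrE//; apply: le_trans (ler_dist_dist _ _) _.
  have -> : x - c' - (x - c) = c - c' by ring.
  by rewrite distrC.
- rewrite -expRD ler_expR.
  have h1 : `|x| <= `|x - c| + `|c| by rewrite -[x in leLHS](subrK c) ler_normD.
  have h2 : `|x| <= `|x - c'| + `|c| + 1.
    rewrite -[x in leLHS](subrK c'); apply: le_trans (ler_normD _ _) _.
    rewrite -addrA lerD2l -[c' in leLHS](subrK c).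
    by apply: le_trans (ler_normD _ _) _; rewrite [leRHS]addrC lerD2r.
  have h3 : `|x| - `|c| - 1 <= Num.min `|x - c'| `|x - c|.
    by rewrite le_min; apply/andP; split; lra.
  nra.
Qed.

Lemma cvg_cder_quotient (F : R -> C) (c : R) (d : C) (cn : nat -> R) :
  is_cder F c d -> cn n @[n --> \oo] --> c -> (forall n, cn n != c) ->
  normsq ((cn n - c)^-1%:C%C * (F (cn n) - F c) - d) @[n --> \oo] --> (0 : R).
Proof.
move=> [/is_derive1_caratheodory[p [pE pc pd]] /is_derive1_caratheodory[q [qE qc qd]]] cnc cn0.
have E n : normsq ((cn n - c)^-1%:C%C * (F (cn n) - F c) - d) =
    (p (cn n) - p c) * (p (cn n) - p c) + (q (cn n) - q c) * (q (cn n) - q c).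
  have n0 : cn n - c != 0 by rewrite subr_eq0.
  rewrite /normsq !ReD !ImD !ReN !ImN !ReM !ImM /= !mul0r subr0 addr0.
  rewrite !ReD !ImD !ReN !ImN -/(reF F (cn n)) -/(reF F c) -/(imF F (cn n)) -/(imF F c).
  rewrite pE qE pd qd -!expr2.
  by congr (_ ^+ 2 + _ ^+ 2); rewrite mulrCA mulVf// mulr1.
rewrite (_ : (fun n => _) = fun n =>
   (p (cn n) - p c) * (p (cn n) - p c) + (q (cn n) - q c) * (q (cn n) - q c)); last first.
  by apply/funext => n; exact: E.
have p0 : p (cn n) - p c @[n --> \oo] --> (0 : R).
  rewrite -(subrr (p c)); apply: cvgB; last exact: cvg_cst.
  by apply: continuous_cvg => //; exact: pc.
have q0 : q (cn n) - q c @[n --> \oo] --> (0 : R).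
  rewrite -(subrr (q c)); apply: cvgB; last exact: cvg_cst.
  by apply: continuous_cvg => //; exact: qc.
by rewrite -[X in _ --> X](addr0 (0 : R)) -{1}[0](mulr0 0) -[X in _ --> _ + X](mulr0 (0 : R));
  apply: cvgD; apply: cvgM.
Qed.

Lemma is_cder_abs w (c x : R) : x != c ->
  is_cder (fun y => wexp w `|x - y|) c (- w * (exp_right w c x - exp_left w c x)).
Proof.
move=> xc; rewrite /exp_right /exp_left.
have [xltc|cltx|/eqP] := ltgtP x c; last by rewrite (negbTE xc).
- rewrite sub0r mulrNN.
  apply: near_is_cder (is_cder_wexp_shift w x c).
  near=> y; rewrite distrC gtr0_norm// subr_gt0.
  by near: y; exact: lt_nbhsr.
- rewrite subr0; apply: near_is_cder (is_cder_wexp_rev w x c).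
  near=> y; rewrite gtr0_norm// subr_gt0.
  by near: y; exact: lt_nbhsl.
Unshelve. all: end_near. Qed.

Lemma not_L2_exp (S : set R) (A v : C) (k0 : R) h : measurable S ->
  mu S = +oo%E -> 0 < k0 -> (forall x, S x -> k0 <= normsq (wexp v x)) -> L2 h ->
  (forall x, S x -> h x = A * wexp v x) -> A = 0.
Proof.
move=> mS Sy k00 kS /L2P[mh h2] hS; apply: normsq_eq0; apply/eqP; apply: contraTT h2 => A0.
rewrite -leNgt.
have sA : 0 < normsq A by rewrite lt_neqAle eq_sym A0 normsq_ge0.
have -> : +oo%E = (\int[mu]_(x in S) (normsq A * k0)%:E)%E.
  transitivity ((normsq A * k0)%:E * mu S)%E; last by rewrite integral_cst.
  by rewrite Sy gt0_muley// lte_fin mulr_gt0.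
apply: (@le_trans _ _ (\int[mu]_(x in S) (normsq (h x))%:E)%E).
  apply: ge0_le_integral => //.
  - by move=> x _; rewrite lee_fin mulr_ge0 ?normsq_ge0// ltW.
  - apply/measurable_EFinP; apply: measurable_funTS; exact: measurable_normsq.
  - by move=> x Sx; rewrite lee_fin hS// normsqM ler_pM2l// kS.
apply: ge0_subset_integral => //.
- exact: emeasurable_normsq.
- by move=> x _; rewrite lee_fin normsq_ge0.
Qed.

(** Near [- oo] the term [e^(w x)] grows, while the other one is square
integrable, so a square integrable combination cannot contain it. *)
Lemma L2_left_coef_eq0 w f A B q : Re w < 0 -> L2 f ->
  {ae mu, forall x, x < q -> f x = A * wexp w x + B * wexp (- w) x} -> A = 0.
Proof.
move=> w0 f2 fAB.
pose h x : C := if x < q then A * wexp w x else 0.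
have mh : cmeasurable h.
  apply: cmeasurable_if; [exact: measurable_fun_ltr| |exact: cmeasurable_cst].
  by apply: cmeasurableZ; apply: cmeasurable_csmooth; exact: csmooth_wexp.
pose g x := f x - (B * wexp (- w) q) * exp_left w q x.
have g2 : L2 g by apply: L2B => //; apply: L2Z; exact: L2_exp_left.
have gq2 : L2 (fun x => if x < q then g x else 0).
  apply: (L2_le _ g) => //.
    apply: cmeasurable_if; [exact: measurable_fun_ltr|exact: L2_cmeasurable|exact: cmeasurable_cst].
  by move=> x; case: ifP => // _; rewrite normsq0 normsq_ge0.
have h2 : L2 h.
  apply: L2_ae_eq mh gq2 _; apply: ae_imply fAB => x fx; rewrite /h; case: ifP => // xq.
  rewrite /g (fx xq) /exp_left xq.
  have -> : wexp (- w) x = wexp (- w) q * wexp w (q - x).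
    by rewrite -opprB -wexpN -wexpD [q + _]addrC subrK.
  ring.
apply: (not_L2_exp `]-oo, q[%classic A w (expR (2 * (Re w * q))) h) => //.
- by rewrite lebesgue_measure_itv /= ltNyr.
- exact: expR_gt0.
- move=> x; rewrite /= in_itv /= => xq; rewrite normsq_wexp ler_expR ler_pM2l//.
  by rewrite ler_nM2l// ltW.
- by move=> x; rewrite /= in_itv /= /h => ->.
Qed.

(** Mirror image of [L2_left_coef_eq0]. *)
Lemma L2_right_coef_eq0 w f A B q : Re w < 0 -> L2 f ->
  {ae mu, forall x, q < x -> f x = A * wexp w x + B * wexp (- w) x} -> B = 0.
Proof.
move=> w0 f2 fAB.
pose h x : C := if q < x then B * wexp (- w) x else 0.
have mh : cmeasurable h.
  apply: cmeasurable_if; [exact: measurable_fun_ltr| |exact: cmeasurable_cst].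
  by apply: cmeasurableZ; apply: cmeasurable_csmooth; exact: csmooth_wexp.
pose g x := f x - (A * wexp w q) * exp_right w q x.
have g2 : L2 g by apply: L2B => //; apply: L2Z; exact: L2_exp_right.
have gq2 : L2 (fun x => if q < x then g x else 0).
  apply: (L2_le _ g) => //.
    apply: cmeasurable_if; [exact: measurable_fun_ltr|exact: L2_cmeasurable|exact: cmeasurable_cst].
  by move=> x; case: ifP => // _; rewrite normsq0 normsq_ge0.
have h2 : L2 h.
  apply: L2_ae_eq mh gq2 _; apply: ae_imply fAB => x fx; rewrite /h; case: ifP => // xq.
  rewrite /g (fx xq) /exp_right xq.
  have -> : wexp w x = wexp w q * wexp w (x - q) by rewrite -wexpD [q + _]addrC subrK.
  ring.
apply: (not_L2_exp `]q, +oo[%classic B (- w) (expR (2 * (Re (- w) * q))) h) => //.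
- by rewrite lebesgue_measure_itv /= ltry.
- exact: expR_gt0.
- move=> x; rewrite /= in_itv /= andbT => xq; rewrite normsq_wexp ler_expR ler_pM2l//.
  by rewrite ler_pM2l ?ltW// ReN oppr_gt0.
- by move=> x; rewrite /= in_itv /= andbT /h => ->.
Qed.

End exponential_estimates.

(** * Components of the complement of a closed set *)

Section components.
Context {R : realType}.
Implicit Types (G : set R).

(** The connected component of [q] in the complement of [G], described through
segments so that no point has to be chosen on its boundary. *)
Definition gap G (q : R) : set R :=
  [set x | forall y, (x <= y <= q) || (q <= y <= x) -> ~ G y].

Lemma gap_sub G q : gap G q `<=` ~` G.
Proof. by move=> x; apply; rewrite lexx /=; case: (leP x q) => // /ltW ->. Qed.

Lemma gap_refl G q : ~ G q -> gap G q q.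
Proof. by move=> nG y; rewrite orbb -eq_le => /eqP <-. Qed.

Lemma gap_sym G q x : gap G q x -> gap G x q.
Proof. by move=> h y; rewrite orbC; exact: h. Qed.

Lemma gap_trans G q x p : gap G q x -> gap G p q -> gap G p x.
Proof.
move=> h1 h2 y /orP[/andP[xy yp]|/andP[py yx]].
- have [yq|/ltW qy] := leP y q; first by apply: h1; rewrite xy yq.
  by apply: h2; rewrite qy yp.
- have [yq|/ltW qy] := leP y q; first by apply: h2; rewrite py yq orbT.
  by apply: h1; rewrite qy yx orbT.
Qed.

Lemma gap_interval G q : is_interval (gap G q).
Proof.
move=> x t cx ct y /andP[xy yt] s /orP[/andP[ys sq]|/andP[qs sy]].
- by apply: cx; rewrite (le_trans xy ys) sq.
- by apply: ct; rewrite qs (le_trans sy yt) orbT.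
Qed.

Lemma gap_open G q : closed G -> open (gap G q).
Proof.
move=> cG; rewrite openE => x cx.
have : nbhs x (~` G).
  by apply: open_nbhs_nbhs; split; [exact: closed_openC|exact: gap_sub cx].
move=> /nbhs_ballP[e /= e0 eG]; apply/nbhs_ballP; exists e => //= y.
rewrite /ball /= ltr_norml => /andP[h1 h2].
apply: gap_trans cx => s /orP[/andP[s1 s2]|/andP[s1 s2]]; apply: eG;
  by rewrite /ball /= ltr_norml; apply/andP; split; lra.
Qed.

(** A finite left end is the largest point of [G] below [q], which exists since
[G] is closed. *)
Lemma gap_left G q : closed G -> ~ G q ->
  (forall x, x <= q -> gap G q x) \/
  exists a, [/\ G a, a < q & forall x, x <= q -> (gap G q x <-> a < x)].
Proof.
move=> cG nGq; pose S := G `&` [set x | x <= q].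
have [S0|nS] := pselect (S !=set0); last first.
  left=> x xq y h Gy; apply: nS; exists y; split => //=.
  by case/orP: h => /andP[h1 h2] //; exact: le_trans xq.
right.
have cS : closed S by apply: closedI => //; exact: closed_le.
have ubS : has_ubound S by exists q => y [].
have Sa : S (sup S).
  by rewrite [X in X _](closure_id S).1//; exact: closure_sup.
have aq : sup S < q.
  rewrite lt_neqAle Sa.2 andbT; apply/eqP => e; apply: nGq; rewrite -e.
  exact: Sa.1.
exists (sup S); split; [exact: Sa.1|exact: aq|].
move=> x xq; split.
  move=> cx; rewrite ltNge; apply/negP => xa; apply: (cx (sup S)); last exact: Sa.1.
  by rewrite xa (ltW aq).
move=> ax y h Gy.
have yq : y <= q by case/orP: h => /andP[h1 h2] //; exact: le_trans xq.
have ya : y <= sup S by apply: sup_upper_bound; [split|split].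
case/orP: h => /andP[h1 h2].
  by have := lt_le_trans ax (le_trans h1 ya); rewrite ltxx.
by apply: nGq; rewrite -(_ : y = q)//; apply/eqP; rewrite eq_le yq h1.
Qed.

Lemma gap_right G q : closed G -> ~ G q ->
  (forall x, q <= x -> gap G q x) \/
  exists b, [/\ G b, q < b & forall x, q <= x -> (gap G q x <-> x < b)].
Proof.
move=> cG nGq; pose G' := (fun x => - x) @^-1` G.
have cG' : closed G'.
  by apply: (preimage_closed _ cG) => x _; apply: cvgN; exact: cvg_id.
have nG' : ~ G' (- q) by rewrite /G' /= opprK.
have E x : gap G q x <-> gap G' (- q) (- x).
  split=> h y hy.
  - apply: h; apply/orP; case/orP: hy => /andP[h1 h2]; [right|left];
      by apply/andP; split; lra.
  - have := h (- y); rewrite /G' /= opprK; apply.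
    by rewrite !lerN2 andbC [X in _ || X]andbC orbC.
have [h|[a [Ga aq h]]] := gap_left _ _ cG' nG'.
  by left=> x qx; apply/E; apply: h; rewrite lerN2.
right; exists (- a); split => //.
- by rewrite ltrNr.
- move=> x qx; have := h (- x); rewrite lerN2 => /(_ qx) {}h.
  by split=> [/E/h|]; rewrite ltrNr// => /h/E.
Qed.

End components.

(** * Density and isolated points give totality *)

Section sufficiency.
Context {R : realType}.
Local Notation C := R[i].
Local Notation mu := (@lebesgue_measure R).
Implicit Types (f g h : R -> C).
Context (z : C) (z0 : ~~ (0 <= z)) (G S1 S2 : set R).
Context (cG : closed G) (nG : mu G = 0%E).
Context (S1d : G `<=` closure S1) (S2i : isolated G `<=` S2).
Local Notation w := (decay_exp z).
Local Notation T := (L2closure (cspan (Bset z S1 S2))).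

Let spanL2 : cspan (Bset z S1 S2) `<=` @L2 R.
Proof. by apply: cspan_L2; exact: Bset_L2. Qed.

Let TD f g : T f -> T g -> T (fun x => f x + g x).
Proof. by apply: L2closureD => // a b; exact: cspanD. Qed.

Let TZ f (c : C) : T f -> T (fun x => c * f x).
Proof. by apply: L2closureZ => // d a; exact: cspanZ. Qed.

Let Tae f g : cmeasurable g -> {ae mu, forall x, f x = g x} -> T f -> T g.
Proof. exact: L2closure_ae. Qed.

Let Tlim f : L2 f ->
  (forall e : R, 0 < e ->
     exists2 g, T g & (L2sq (fun x => f x - g x)%R < e%:E)%E) -> T f.
Proof. exact: L2closure_lim. Qed.

Let Tbase b : Bset z S1 S2 b -> T b.
Proof. by move=> Bb; apply: sub_L2closure => //; exact: cspan_base. Qed.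

Let w_lt0 : Re w < 0.
Proof. exact: Re_decay_exp_lt0. Qed.

Let w_neq0 : w != 0.
Proof. exact: decay_exp_neq0. Qed.

Let s := - 2 * Re w.

Let s_gt0 : 0 < s.
Proof. by rewrite /s mulNr oppr_gt0 pmulr_rlt0. Qed.

Lemma gz_abs c x : wexp w `|x - c| = - (2 * w) * gz z (x - c).
Proof. by rewrite gzE//; field. Qed.

Lemma L2_abs c : L2 (fun x => wexp w `|x - c|).
Proof.
have -> : (fun x => wexp w `|x - c|) = fun x => - (2 * w) * gz z (x - c).
  by apply/funext => x; exact: gz_abs.
by apply: L2Z; exact: L2_gz.
Qed.

Lemma closure_abs_S1 c : S1 c -> T (fun x => wexp w `|x - c|).
Proof.
move=> Sc; have -> : (fun x => wexp w `|x - c|) = fun x => - (2 * w) * gz z (x - c).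
  by apply/funext => x; exact: gz_abs.
by apply: TZ; apply: Tbase; left; exists c.
Qed.

(** By density, [c] is a limit of points of [S1], and translation is continuous
in the mean. *)
Lemma closure_abs c : G c -> T (fun x => wexp w `|x - c|).
Proof.
move=> Gc; apply: Tlim; first exact: L2_abs.
move=> e e0; have iE := integrable_expR_abs s s_gt0.
pose J := (\int[mu]_x expR (- s * `|x|))%R.
have J0 : 0 <= J by apply: Rintegral_ge0 => x _; exact: expR_ge0.
have K0 : 0 <= translate_const w c by rewrite !mulr_ge0 ?normsq_ge0 ?expR_ge0.
have M0 : 0 < translate_const w c * J + 1 by rewrite ltr_wpDl// mulr_ge0.
(* The bound [1] makes [d ^+ 2 <= d], so a linear choice of [d] in [e] suffices
   for the quadratic estimate. *)
pose d := Num.min 1 (e / (translate_const w c * J + 1)).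
have d0 : 0 < d by rewrite lt_min ltr01 divr_gt0.
have [c' [Sc' cc']] := S1d _ Gc _ (nbhsx_ballx c d d0).
have {}cc' : `|c' - c| < d by rewrite distrC.
exists (fun x => wexp w `|x - c'|); first exact: closure_abs_S1.
have h1 : `|c' - c| <= 1 by rewrite ltW// (lt_le_trans cc')// ge_min lexx.
have h2 : `|c' - c| < e / (translate_const w c * J + 1).
  by rewrite (lt_le_trans cc')// ge_min lexx orbT.
rewrite L2sq_subC.
have iL := integrableZlR (translate_const w c * (c' - c) ^+ 2) _ iE.
apply: (@le_lt_trans _ _ (\int[mu]_x (translate_const w c * (c' - c) ^+ 2 * expR (- s * `|x|))%R%:E)%E).
  apply: ge0_le_integral => //.
  - by move=> x _; rewrite lee_fin normsq_ge0.
  - by apply: emeasurable_normsq; apply: cmeasurableB; apply: L2_cmeasurable; exact: L2_abs.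
  - by have /integrableP[] := iL.
  - by move=> x _; rewrite lee_fin; exact: normsq_wexp_abs_translate.
have fn := integrable_fin_num measurableT iL.
rewrite -[ltLHS](fineK fn) lte_fin.
have -> : fine (\int[mu]_x (translate_const w c * (c' - c) ^+ 2 * expR (- s * `|x|))%R%:E)%E =
    translate_const w c * (c' - c) ^+ 2 * J by exact: RintegralZl.
rewrite -(real_normK (num_real (c' - c))).
apply: (@le_lt_trans _ _ ((translate_const w c * J + 1) * `|c' - c|)).
  have : `|c' - c| ^+ 2 <= `|c' - c| by rewrite expr2 ler_piMr.
  have := mulr_ge0 K0 J0; have := normr_ge0 (c' - c); nra.
by rewrite mulrC -ltr_pdivlMr.
Qed.

(** At an isolated point this is, off [c], a multiple of a generator. Otherwise [c]
is a limit of points of [G], and the difference quotients of the translates of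
[e^(w |x|)] at these points converge in the mean to the derivative with respect
to [c]. *)
Lemma closure_sub_pm c : G c -> T (fun x => exp_right w c x - exp_left w c x).
Proof.
move=> Gc.
have mpm : cmeasurable (fun x => exp_right w c x - exp_left w c x).
  by apply: cmeasurableB; [exact: cmeasurable_exp_right|exact: cmeasurable_exp_left].
have pm2 : L2 (fun x => exp_right w c x - exp_left w c x).
  by apply: L2B; [exact: L2_exp_right|exact: L2_exp_left].
have [iso|niso] := pselect (isolated G c).
  have Tc : T (fun x => -2 * cderive (gz z) (x - c)).
    by apply: TZ; apply: Tbase; right; exists c => //; exact: S2i.
  apply: (Tae _ _ mpm _ Tc); apply: ae_imply (ae_dgz _ z0 c) => x <-.
  by field.
have near_G (n : nat) : exists y, [/\ G y, y != c & `|y - c| < n.+1%:R^-1].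
  apply: contrapT => h; apply: niso; split; first exact: mem_set.
  have n0 : (0 : R) < n.+1%:R^-1 by rewrite invr_gt0.
  exists (ball c n.+1%:R^-1); first exact: nbhsx_ballx.
  apply/seteqP; split => [y [cy Gy]|y ->]; last by split => //; exact: ballxx.
  apply: contrapT => yc; apply: h; exists y; split => //; first exact/eqP.
  by rewrite distrC.
have [cn cnP] := choice near_G.
have cnc : cn n @[n --> \oo] --> c.
  apply/cvgrPdist_lt => e e0; near=> n.
  have [_ _ h] := cnP n; rewrite distrC; apply: lt_trans h _.
  by near: n; exact: near_infty_natSinv_lt (PosNum e0).
suff Tw : T (fun x => - w * (exp_right w c x - exp_left w c x)).
  have := TZ _ (- w^-1) Tw; apply: Tae mpm _.
  by apply: aeW => x; field.
have mwpm : cmeasurable (fun x => - w * (exp_right w c x - exp_left w c x)) by exact: cmeasurableZ.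
pose Q n x : C := (cn n - c)^-1%:C%C * (wexp w `|x - cn n| - wexp w `|x - c|).
have TQ n : T (Q n).
  have -> : Q n = fun x => (cn n - c)^-1%:C%C * (wexp w `|x - cn n| + (-1) * wexp w `|x - c|).
    by apply/funext => x; rewrite mulN1r.
  apply: TZ; apply: TD; first by apply: closure_abs; have [] := cnP n.
  by apply: TZ; exact: closure_abs.
have mQ n : cmeasurable (Q n) by apply: L2_cmeasurable; have [] := TQ n.
apply: Tlim; first exact: L2Z.
(* The dominating constant: twice the bound of the quotient plus twice that of
   its limit. *)
pose K0 := 2 * translate_const w c + 4 * normsq w * expR (- 2 * (Re w * `|c|)).
have iH := integrableZlR K0 _ (integrable_expR_abs s s_gt0).
have bound n x : normsq (Q n x - - w * (exp_right w c x - exp_left w c x)) <= K0 * expR (- s * `|x|).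
  have [_ cn0 cn1] := cnP n.
  have cn1' : `|cn n - c| <= 1.
    by rewrite (le_trans (ltW cn1))// invf_le1// ler1n.
  have d0 : cn n - c != 0 by rewrite subr_eq0.
  have hQ : normsq (Q n x) <= translate_const w c * expR (- s * `|x|).
    rewrite /Q normsqM; have := normsq_wexp_abs_translate w c (cn n) x w_lt0 cn1'.
    have -> : normsq ((cn n - c)^-1)%:C%C = (cn n - c) ^- 2.
      by rewrite /normsq /= expr0n addr0 exprVn.
    move=> h; rewrite mulrC ler_pdivrMr; last by rewrite exprn_even_gt0.
    by apply: le_trans h _; rewrite mulrAC.
  have hL : normsq (- w * (exp_right w c x - exp_left w c x)) <=
      2 * normsq w * expR (- 2 * (Re w * `|c|)) * expR (- s * `|x|).
    rewrite normsqM normsqN.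
    have -> : 2 * normsq w * expR (- 2 * (Re w * `|c|)) * expR (- s * `|x|) =
      normsq w * (2 * (expR (- 2 * (Re w * `|c|)) * expR (- s * `|x|))) by ring.
    rewrite ler_wpM2l ?normsq_ge0//.
    have := expR_shift_le w c x w_lt0; rewrite -/s => hs.
    apply: le_trans (_ : 2 * expR (2 * (Re w * `|x - c|)) <= _); last first.
      by rewrite ler_wpM2l.
    rewrite /exp_right /exp_left; have [xc|cx|_] := ltgtP x c.
    - rewrite sub0r normsqN normsq_wexp distrC gtr0_norm ?subr_gt0//.
      by rewrite ler_peMl ?expR_ge0// ler1n.
    - rewrite subr0 normsq_wexp gtr0_norm ?subr_gt0//.
      by rewrite ler_peMl ?expR_ge0// ler1n.
    - by rewrite subr0 normsq0 mulr_ge0 ?expR_ge0.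
  apply: le_trans (normsqD_le _ _) _; rewrite normsqN.
  have -> : K0 * expR (- s * `|x|) = 2 * (translate_const w c * expR (- s * `|x|) +
      2 * normsq w * expR (- 2 * (Re w * `|c|)) * expR (- s * `|x|)).
    by rewrite /K0; ring.
  by rewrite ler_wpM2l// lerD.
have cv : {ae mu, forall x,
    normsq (Q n x - - w * (exp_right w c x - exp_left w c x)) @[n --> \oo] --> (0 : R)}.
  apply: ae_imply (ae_neq c) => x xc.
  apply: (cvg_cder_quotient (fun y => wexp w `|x - y|) c _ cn) => //.
    exact: is_cder_abs.
  by move=> n; have [] := cnP n.
move=> e e0.
have [n Qn] := L2sq_dominated _ _ _ mQ mwpm iH bound cv e e0.
by exists (Q n) => //; exact: TQ.
Unshelve. all: end_near. Qed.

Lemma closure_add_pm c : G c -> T (fun x => exp_right w c x + exp_left w c x).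
Proof.
move=> Gc; apply: Tae (closure_abs c Gc).
  by apply: cmeasurableD; [exact: cmeasurable_exp_right|exact: cmeasurable_exp_left].
apply: ae_imply (ae_gz _ z0 c) => x h; rewrite gz_abs -h.
by field.
Qed.

Lemma closure_exp_right c : G c -> T (exp_right w c).
Proof.
move=> Gc; have := TZ _ 2^-1 (TD _ _ (closure_add_pm c Gc) (closure_sub_pm c Gc)).
apply: Tae; first exact: cmeasurable_exp_right.
by apply: aeW => x; field.
Qed.

Lemma closure_exp_left c : G c -> T (exp_left w c).
Proof.
move=> Gc.
have := TZ _ 2^-1 (TD _ _ (closure_add_pm c Gc) (TZ _ (-1) (closure_sub_pm c Gc))).
apply: Tae; first exact: cmeasurable_exp_left.
by apply: aeW => x; field.
Qed.

Lemma closure_cst0 : T (fun=> 0).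
Proof.
apply: sub_L2closure => //; exists 0%N, (fun=> 0), (fun=> fun=> 0); split; first by case.
by apply/funext => x; rewrite big_ord0.
Qed.

Lemma measurable_mem_set (A : set R) : measurable A ->
  measurable_fun setT (fun x : R => x \in A).
Proof.
move=> mA; apply: (@measurable_fun_bool _ _ _ _ true); rewrite setTI.
rewrite (_ : _ @^-1` _ = A)//; apply/seteqP; split => x /=; first exact: set_mem.
exact: mem_set.
Qed.

Lemma cmeasurable_cut (A : set R) f : measurable A -> cmeasurable f ->
  cmeasurable (fun x => if x \in A then f x else 0).
Proof. by move=> mA mf; apply: cmeasurable_if => //; [exact: measurable_mem_set|exact: cmeasurable_cst]. Qed.

Lemma gap_measurable q : measurable (gap G q).
Proof. by apply: open_measurable; exact: gap_open. Qed.

(** On a component of the complement, [f] is [A e^(w x) + B e^(- w x)], and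
each term restricted to the component is a difference of half-line
exponentials issued from its ends, which belong to [G]. When an end is
infinite, the term that grows there is absent by square integrability. *)
Lemma closure_cut q f : ~ G q -> deficiency z G f ->
  T (fun x => if x \in gap G q then f x else 0).
Proof.
move=> nGq /(deficiencyP z)[f2 fw].
have Iq := gap_refl _ _ nGq.
have weak u : test_on (gap G q) u -> cintegral (fun x => f x * helmholtz w u x) = 0.
  move=> [su [a [b [abI u0]]]]; apply: fw; apply: (Cc_infty_itv G a b) => //.
  by apply: subset_trans abI _; exact: gap_sub.
have [A [B fAB]] := weak_solution_exp _ _ _ _ w_neq0 (gap_open G q cG)
  (gap_interval G q) Iq f2 weak.
have mI := gap_measurable q.
have mA : cmeasurable (fun x => if x \in gap G q then A * wexp w x else 0).
  by apply: cmeasurable_cut => //; apply: cmeasurableZ; apply: cmeasurable_csmooth; exact: csmooth_wexp.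
have mB : cmeasurable (fun x => if x \in gap G q then B * wexp (- w) x else 0).
  by apply: cmeasurable_cut => //; apply: cmeasurableZ; apply: cmeasurable_csmooth; exact: csmooth_wexp.
have out x : ~ gap G q x -> (x \in gap G q) = false.
  by move=> nx; apply/negP => /set_mem.
have inn x : gap G q x -> (x \in gap G q) = true by exact: mem_set.
have wexpE a x : wexp w x = wexp w a * wexp w (x - a).
  by rewrite -wexpD [a + _]addrC subrK.
have wexpNE a x : wexp (- w) x = wexp (- w) a * wexp w (a - x).
  by rewrite -opprB -wexpN -wexpD [a + _]addrC subrK.
have TA : T (fun x => if x \in gap G q then A * wexp w x else 0).
  (* No left end: [e^(w x)] would grow at [- oo]. *)
  have [lf|[a [Ga aq la]]] := gap_left G q cG nGq.
    have -> : A = 0.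
      apply: (L2_left_coef_eq0 w f A B q w_lt0 f2); apply: ae_imply fAB => x h xq.
      by apply: h; apply: lf; exact: ltW.
    rewrite (_ : (fun _ => _) = fun=> 0); first exact: closure_cst0.
    by apply/funext => x; rewrite mul0r if_same.
  have [rt|[b [Gb qb rb]]] := gap_right G q cG nGq.
    apply: Tae mA _ (TZ _ (A * wexp w a) (closure_exp_right a Ga)).
    apply: ae_imply (ae_neq a) => x xa; rewrite /exp_right.
    have [xq|/ltW qx] := leP x q.
      have [ax|ax] := ltP a x; first by rewrite inn ?[in RHS](wexpE a x) ?mulrA//; apply/la.
      by rewrite out ?mulr0// => /la; rewrite ltNge ax => /(_ xq).
    rewrite (lt_le_trans aq qx) inn ?[in RHS](wexpE a x) ?mulrA//; exact: rt.
  have := TD _ _ (TZ _ (A * wexp w a) (closure_exp_right a Ga)) (TZ _ (- (A * wexp w b)) (closure_exp_right b Gb)).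
  apply: Tae mA _; apply: ae_imply (ae_and _ _ (ae_neq a) (ae_neq b)) => x [xa xb]; rewrite /exp_right.
  have [xq|/ltW qx] := leP x q.
    rewrite [b < x]ltNge (le_trans xq (ltW qb)) /= mulr0 addr0.
    have [ax|ax] := ltP a x.
      by rewrite inn ?[in RHS](wexpE a x) ?mulrA//; apply/la.
    by rewrite out ?mulr0// => /la; rewrite ltNge ax => /(_ xq).
  rewrite (lt_le_trans aq qx).
  have [bx|xb'] := ltP b x.
    rewrite out; last by move=> /rb; rewrite ltNge (ltW bx) => /(_ qx).
    by rewrite mulNr -[X in X - _]mulrA -[X in _ - X]mulrA -(wexpE a) -(wexpE b) subrr.
  rewrite inn; last by apply/rb => //; rewrite lt_neqAle xb xb'.
  by rewrite mulr0 addr0 [in RHS](wexpE a x) mulrA.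
have TB : T (fun x => if x \in gap G q then B * wexp (- w) x else 0).
  (* No right end: [e^(- w x)] would grow at [+ oo]. *)
  have [rt|[b [Gb qb rb]]] := gap_right G q cG nGq.
    have -> : B = 0.
      apply: (L2_right_coef_eq0 w f A B q w_lt0 f2); apply: ae_imply fAB => x h xq.
      by apply: h; apply: rt; exact: ltW.
    rewrite (_ : (fun _ => _) = fun=> 0); first exact: closure_cst0.
    by apply/funext => x; rewrite mul0r if_same.
  have [lf|[a [Ga aq la]]] := gap_left G q cG nGq.
    apply: Tae mB _ (TZ _ (B * wexp (- w) b) (closure_exp_left b Gb)).
    apply: ae_imply (ae_neq b) => x xb; rewrite /exp_left.
    have [qx|/ltW xq] := leP q x.
      have [bx|bx] := ltP x b; first by rewrite inn ?[in RHS](wexpNE b x) ?mulrA//; apply/rb.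
      by rewrite out ?mulr0// => /rb; rewrite ltNge bx => /(_ qx).
    rewrite (le_lt_trans xq qb) inn ?[in RHS](wexpNE b x) ?mulrA//; exact: lf.
  have := TD _ _ (TZ _ (B * wexp (- w) b) (closure_exp_left b Gb)) (TZ _ (- (B * wexp (- w) a)) (closure_exp_left a Ga)).
  apply: Tae mB _; apply: ae_imply (ae_and _ _ (ae_neq a) (ae_neq b)) => x [xa xb]; rewrite /exp_left.
  have [qx|/ltW xq] := leP q x.
    rewrite [x < a]ltNge (le_trans (ltW aq) qx) /= mulr0 addr0.
    have [bx|bx] := ltP x b.
      by rewrite inn ?[in RHS](wexpNE b x) ?mulrA//; apply/rb.
    by rewrite out ?mulr0// => /rb; rewrite ltNge bx => /(_ qx).
  rewrite (le_lt_trans xq qb).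
  have [ax|xa'] := ltP x a.
    rewrite out; last by move=> /la; rewrite ltNge (ltW ax) => /(_ xq).
    by rewrite mulNr -[X in X - _]mulrA -[X in _ - X]mulrA -(wexpNE a) -(wexpNE b) subrr.
  rewrite inn; last by apply/la => //; rewrite lt_neqAle eq_sym xa xa'.
  by rewrite mulr0 addr0 [in RHS](wexpNE b x) mulrA.
have := TD _ _ TA TB; apply: Tae; first by apply: cmeasurable_cut => //; exact: L2_cmeasurable.
apply: ae_imply fAB => x fx; case: ifP => [/set_mem cx|_]; last by rewrite addr0.
by rewrite fx.
Qed.

(** An enumeration, with repetitions and empty sets, of the components of the
complement: each of them contains a rational number. *)
Definition rational_gap n : set R :=
  [set x | exists q : rat, [/\ unpickle n = Some q, ~ G (ratr q) & gap G (ratr q) x]].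

Lemma open_rational_gap n : open (rational_gap n).
Proof.
case E : (unpickle n : option rat) => [q|]; last first.
  rewrite (_ : rational_gap n = set0); first exact: open0.
  by apply/seteqP; split => // x [p []]; rewrite E.
have [Gq|nGq] := pselect (G (ratr q)).
  rewrite (_ : rational_gap n = set0); first exact: open0.
  by apply/seteqP; split => // x [p []]; rewrite E => -[<-].
rewrite (_ : rational_gap n = gap G (ratr q)); first exact: gap_open.
apply/seteqP; split => x; first by move=> [p []]; rewrite E => -[<-].
by move=> cx; exists q.
Qed.

Definition first_gaps n : set R := [set x | exists2 k, (k < n)%N & rational_gap k x].

Lemma measurable_first_gaps n : measurable (first_gaps n).
Proof.
apply: open_measurable.
rewrite (_ : first_gaps n = \bigcup_(k in [set k | (k < n)%N]) rational_gap k).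
  by apply: bigcup_open => k _; exact: open_rational_gap.
by apply/seteqP; split => x [k kn cx]; exists k.
Qed.

(** A new component either is already present or is disjoint from the previous
ones. *)
Lemma closure_cut_first_gaps n f : deficiency z G f ->
  T (fun x => if x \in first_gaps n then f x else 0).
Proof.
move=> Nf; elim: n => [|n IH].
  rewrite (_ : (fun _ => _) = fun=> 0); first exact: closure_cst0.
  by apply/funext => x; case: ifP => // /set_mem[].
have US x : first_gaps n.+1 x <-> first_gaps n x \/ rational_gap n x.
  split=> [[k]|[[k kn cx]|cx]].
  - rewrite ltnS leq_eqVlt => /predU1P[->|kn] cx; first by right.
    by left; exists k.
  - by exists k => //; exact: ltnW.
  - by exists n.
have same : (forall x, rational_gap n x -> first_gaps n x) ->
    T (fun x => if x \in first_gaps n.+1 then f x else 0).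
  move=> sub; rewrite (_ : first_gaps n.+1 = first_gaps n)//.
  by apply/seteqP; split => x; [move=> /US[|/sub]|move=> ?; apply/US; left].
have [none|/existsNP[x0 /not_implyP[x0n nx0]]] :=
    pselect (forall x, rational_gap n x -> first_gaps n x); first exact: same.
have [q [Eq nGq cx0]] := x0n.
have rgE : rational_gap n = gap G (ratr q).
  apply/seteqP; split => x; first by move=> [p []]; rewrite Eq => -[<-].
  by move=> cx; exists q.
have disj x : rational_gap n x -> ~ first_gaps n x.
  rewrite rgE => cx [k kn [p [exp_right nGp cpx]]]; apply: nx0; exists k => //.
  exists p; split => //.
  by apply: gap_trans cx0 _; apply: gap_trans cpx; exact: gap_sym.
have := TD _ _ IH (closure_cut _ _ nGq Nf).
congr (L2closure _ _); apply/funext => x.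
have [ux|nux] := pselect (first_gaps n x).
  rewrite mem_set// [x \in first_gaps n.+1]mem_set; last by apply/US; left.
  rewrite ifF ?addr0//; apply/negP => /set_mem; rewrite -rgE => /disj.
  exact.
rewrite memNset// add0r -rgE; have [nx|nnx] := pselect (rational_gap n x).
  by rewrite !mem_set//; apply/US; right.
by rewrite !memNset// => /US[].
Qed.

(** The components exhaust the complement of [G], that is, almost the whole line;
by dominated convergence [f] is the limit of its restrictions to finitely many
of them. *)
Lemma deficiency_sub_closure : deficiency z G `<=` T.
Proof.
move=> f Nf; have [f2 _] := Nf; have mf := L2_cmeasurable _ f2.
apply: Tlim => // e e0.
have mcut n : cmeasurable (fun x => if x \in first_gaps n then f x else 0).
  by apply: cmeasurable_cut => //; exact: measurable_first_gaps.
have bound n x : normsq ((if x \in first_gaps n then f x else 0) - f x) <= normsq (f x).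
  by case: ifP => _; rewrite ?subrr ?normsq0 ?normsq_ge0// sub0r normsqN.
have cv : {ae mu, forall x,
    normsq ((if x \in first_gaps n then f x else 0) - f x) @[n --> \oo] --> (0 : R)}.
  exists G; split; [exact: closed_measurable|exact: nG|].
  move=> x /= nx; apply: contrapT => nGx; apply: nx.
  have : nbhs x (gap G x).
    by apply: open_nbhs_nbhs; split; [exact: gap_open|exact: gap_refl].
  move=> /nbhs_ballP[d /= d0 dG].
  have [q] : exists q : rat, ratr q \in `]x, x + d[.
    by apply: rat_in_itvoo; rewrite ltrDl.
  rewrite in_itv /= => /andP[q1 q2].
  have cxq : gap G x (ratr q).
    by apply: dG; rewrite /ball /= ltr_norml; apply/andP; split; lra.
  have nthx : rational_gap (pickle q) x.
    by exists q; split; [exact: pickleK|exact: gap_sub cxq|exact: gap_sym].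
  apply: (cvg_near_cst 0); near=> n.
  rewrite mem_set ?subrr ?normsq0//; exists (pickle q) => //.
  by near: n; exists (pickle q).+1.
have [n fn] := L2sq_dominated _ _ _ mcut mf (integrable_normsq _ f2) bound cv e e0.
by exists (fun x => if x \in first_gaps n then f x else 0) => //; exact: closure_cut_first_gaps.
Unshelve. all: end_near. Qed.

End sufficiency.

Lemma L2closure_deficiency (R : realType) (z : R[i]) (G : set R) (A : set (R -> R[i])) :
  ~~ (0 <= z) -> A `<=` deficiency z G -> L2closure A `<=` deficiency z G.
Proof.
move=> z0 AN; have A2 : A `<=` @L2 R by move=> f /AN[].
move=> f Af; have [f2 _] := Af; apply/(deficiencyP z); split; first exact: f2.
move=> u Gu; have [su _ _] := Gu; have [a [b u0]] := Cc_infty_supp _ _ Gu.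
apply: (pairing_L2closure A _ _ A2 (L2_helmholtz z _ _ _ su u0) Af).
by move=> g /AN /(deficiencyP z)[_]; apply.
Qed.

Lemma cspan_deficiency (R : realType) (z : R[i]) (G : set R) (B : set (R -> R[i])) :
  ~~ (0 <= z) -> B `<=` deficiency z G -> cspan B `<=` deficiency z G.
Proof.
move=> z0 BN; have B2 : B `<=` @L2 R by move=> f /BN[].
move=> f Bf; apply/(deficiencyP z); split; first exact: cspan_L2 Bf.
move=> u Gu; have [su _ _] := Gu; have [a [b u0]] := Cc_infty_supp _ _ Gu.
apply: (cspan_pairing B _ B2 (L2_helmholtz z _ _ _ su u0) _ _ Bf).
by move=> g /BN /(deficiencyP z)[_]; apply.
Qed.

Theorem proposition5 (R : realType) (G : set R)
    (Gclosed : closed G) (Gnull : lebesgue_measure G = 0%E)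
    (S1 S2 : set R) (S1G : S1 `<=` G) (S2G : S2 `<=` G) :
  forall z : R[i], ~~ (0 <= z) ->
    (total_in (Bset z S1 S2) (deficiency z G) <->
     (G `<=` closure S1 /\ isolated G `<=` S2)).
Proof.
move=> z z0; split=> [tot|[S1d S2i]].
  by split; [exact: total_dense tot|exact: total_isolated tot].
have BN := Bset_deficiency z z0 _ _ _ S1G S2G.
split; first exact: BN.
apply/seteqP; split; first exact: deficiency_sub_closure.
by apply: L2closure_deficiency => //; exact: cspan_deficiency.
Qed.
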